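(* Let $G$ be a finite simple planar graph such that no 5-cycle of $G$ is adjacent to two 3-cycles of $G$, and no 5-cycle of $G$ is adjacent to a 4-cycle of $G$ that has a chord. Then $G$ is 4-choosable.
   Context: Two cycles are adjacent if they share at least one edge. A 4-cycle with a chord is a 4-cycle $v_1v_2v_3v_4$ together with an edge $v_1v_3$ (equivalently, two 3-cycles sharing an edge). A graph $G$ is $k$-choosable if for every assignment of lists $L(v)$ with $|L(v)|=k$ to the vertices, there is a proper coloring $c$ with $c(v)\in L(v)$ for all $v$. *)

(* Defs.v *)
From mathcomp Require Import all_boot all_fingroup.

Set Implicit Arguments.
Unset Strict Implicit.
Unset Printing Implicit Defensive.

Record sgraph := SGraph {
  svertex :> finType;
  sedge : rel svertex;
  sedge_sym : symmetric sedge;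
  sedge_irrefl : irreflexive sedge }.

Arguments sedge {G} : rename.
Notation "x -- y" := (sedge x y) (at level 30).

(** Planarity is defined through combinatorial embeddings (rotation systems),
    as customary in formalised graph theory.  A dart is an oriented edge (u, v),
    with tail u.  An embedding of G in an oriented surface is given, up to
    homeomorphism, by the cyclic order of the darts around each vertex; the
    faces are then the orbits of "reverse the dart, then rotate", and the
    surface is a disjoint union of spheres, one for each connected component,
    exactly when Euler's formula V - E + F = 2C holds. *)

Definition dart (G : sgraph) : finType := {p : G * G | p.1 -- p.2}.

Definition tail (G : sgraph) (d : dart G) : G := (sval d).1.

Lemma rev_dart_subproof (G : sgraph) (d : dart G) :
  (sval d).2 -- (sval d).1.
Proof. by rewrite sedge_sym (svalP d). Qed.

Definition rev_dart (G : sgraph) (d : dart G) : dart G :=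
  exist (fun p : G * G => p.1 -- p.2) ((sval d).2, (sval d).1)
    (rev_dart_subproof d).

Lemma rev_dartK (G : sgraph) : involutive (@rev_dart G).
Proof. by move=> [[u v] uv]; apply: val_inj. Qed.

Definition rev_perm (G : sgraph) : {perm dart G} :=
  perm (inv_inj (@rev_dartK G)).

Definition rotation_system (G : sgraph) (s : {perm dart G}) : Prop :=
  forall d d' : dart G, (d' \in porbit s d) = (tail d' == tail d).

(** Products of permutations compose from left to right, so this maps the dart
    (u, v) to the successor of (v, u) in the rotation at v. *)
Definition face_perm (G : sgraph) (s : {perm dart G}) : {perm dart G} :=
  (rev_perm G * s)%g.

(** Isolated vertices carry no dart; they are irrelevant to planarity and are
    left out of both V and C. *)
Definition edge_components (G : sgraph) : nat :=
  n_comp (@sedge G) [pred x | [exists y, x -- y]].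

Definition genus_zero (G : sgraph) (s : {perm dart G}) : Prop :=
  #|porbits s| + #|porbits (face_perm s)| =
    #|porbits (rev_perm G)| + 2 * edge_components G.

Definition planar (G : sgraph) : Prop :=
  exists2 s : {perm dart G}, rotation_system s & genus_zero s.

(** A k-cycle (for k >= 3) is listed from an arbitrary starting vertex in an
    arbitrary direction; as a subgraph it is determined by its set of edges. *)
Definition kcycle (G : sgraph) (k : nat) (c : seq G) : Prop :=
  ucycle sedge c /\ size c = k.

Definition cycle_edges (G : sgraph) (c : seq G) : {set {set G}} :=
  [set [set x; next c x] | x in c].

Definition adjacent_cycles (G : sgraph) (c1 c2 : seq G) : Prop :=
  exists2 f : {set G}, f \in cycle_edges c1 & f \in cycle_edges c2.

Definition has_chord (G : sgraph) (c : seq G) : Prop :=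
  exists x y : G, [/\ x \in c, y \in c, x -- y
                    & [set x; y] \notin cycle_edges c].

Definition choosable (G : sgraph) (k : nat) : Prop :=
  forall (C : finType) (L : G -> {set C}), (forall v, #|L v| = k) ->
  exists c : G -> C,
    (forall v, c v \in L v) /\ (forall u v, u -- v -> c u != c v).

(* Main.v *)
(** Let A be a minimal set of vertices that cannot be colored from the lists,
    and consider the map induced on A.  By the kernel method (a bipartite
    digraph has a kernel, so it can be colored from lists longer than the
    out-degrees), A contains no nonempty set H inducing a bipartite graph in
    which some of the edges can be oriented so that every v in H has in-degree
    at least deg v - 3.  Hence all degrees are at least 4, an induced 4-cycle
    has a vertex of degree at least 5, and two quadrilaterals at a vertex of
    degree 5 whose other vertices all have degree 4 must be separated there by
    a single triangle.

    Give deg v - 4 to each vertex and len - 4 to each face; the total is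
    negative by Euler's formula.  A triangle needs 1/3 through each side, half
    of it at either end of the side.  A face of length at least 6 affords 1/3
    per corner.  Faces of length 4 or 5 have at most one triangle side; a
    4-face that has one gets 1/3 from its vertices of degree at least 5.  Two
    triangles sharing a side are surrounded by faces of length at least 6, and
    the corners at the ends of the shared side make up for the missing third.
    Every vertex and every face then ends up nonnegative. *)

Require Import Defs.
From mathcomp Require Import all_boot all_fingroup.
From mathcomp Require Import zify.

Set Implicit Arguments.
Unset Strict Implicit.
Unset Printing Implicit Defensive.

(** * List coloring by kernels *)

(** Within [S], a vertex of [Y] points only at vertices that point back into [Y], and these are not
    in [X]. A [side] vertex outside [Y] fails the condition of [F], and the witness of this failure
    lies in [X]. *)
Lemma bipartite_kernel (T : finType) (D : rel T) (side : pred T) (S : {set T}) :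
    {in S &, forall u v, D u v -> side u != side v} ->
  exists2 K : {set T}, K \subset S &
    {in K &, forall u v, ~~ D u v} /\
    {in S :\: K, forall u, exists2 v, v \in K & D u v}.
Proof.
move=> bip.
(* The kernel is the least fixed point Y of F together with the vertices on
   the other side that have no out-neighbor in Y. *)
pose F (A : {set T}) := [set y in S | side y &&
  [forall (x | [&& x \in S, ~~ side x & D y x]), exists a in A, D x a]].
have Fmono : {homo F : A B / A \subset B}.
  move=> A B sAB; apply/subsetP=> y; rewrite !inE => /and3P[-> -> /forall_inP h] /=.
  apply/forall_inP=> x /h /exists_inP[a aA xa].
  by apply/exists_inP; exists a; rewrite ?(subsetP sAB).
pose Y := fixset F; have FY : F Y = Y by exact: fixsetK.
have Y_in y : (y \in Y) = (y \in F Y) by rewrite FY.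
pose X := [set x in S | ~~ side x && [forall a in Y, ~~ D x a]].
have YS y : y \in Y -> y \in S /\ side y by rewrite Y_in inE => /and3P[].
have XY x y : x \in X -> y \in Y -> ~~ D x y.
  by rewrite inE => /and3P[_ _ /forall_inP]; apply.
have YX x y : x \in X -> y \in Y -> ~~ D y x.
  move=> xX; rewrite Y_in !inE => /and3P[yS yside /forall_inP h].
  apply/negP=> Dyx; move: (xX); rewrite inE => /and3P[xS xside _].
  have /exists_inP[a aY xa] : [exists a in Y, D x a].
    by apply: h; rewrite xS xside.
  by have := XY _ _ xX aY; rewrite xa.
exists (X :|: Y).
  by apply/subsetP=> z; rewrite inE => /orP[|/YS[]//]; rewrite inE => /and3P[].
split=> [u v|u].
  rewrite !inE => /orP[]uK /orP[]vK; apply/negP=> uv.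
  - have /= := bip _ _ _ _ uv; case/and3P: uK vK => -> /negbTE -> _ /and3P[-> /negbTE -> _].
    by move/(_ isT isT).
  - by have := XY u v; rewrite inE uK vK uv; move/(_ isT isT).
  - by have := YX v u; rewrite inE uK vK uv; move/(_ isT isT).
  - by have [uS su] := YS _ uK; have [vS sv] := YS _ vK; have := bip _ _ uS vS uv; rewrite su sv.
rewrite inE => /andP[]; rewrite inE negb_or => /andP[uX uY] uS.
have [su|su] := boolP (side u).
  move: uY; rewrite Y_in inE uS su /= negb_forall => /existsP[x].
  rewrite negb_imply => /andP[/and3P[xS sx ux]] hx; exists x => //.
  rewrite !inE xS sx /=; apply/orP; left; apply/forall_inP=> a aY; apply/negP=> xa.
  by case/negP: hx; apply/exists_inP; exists a.
move: uX; rewrite !inE uS su /= negb_forall => /existsP[a].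
by rewrite negb_imply negbK => /andP[aY ua]; exists a; rewrite // inE aY orbT.
Qed.

(** Induction on [#|H|]: color with [a] a kernel [K] of the vertices whose lists contain [a], and
    delete [a] from the other lists. A vertex that loses [a] also loses an out-neighbor in [K], so
    the strict inequality survives. [c0] serves as the coloring of the empty set. *)
Lemma bipartite_list_coloring (T C : finType) (D : rel T) (side : pred T)
    (c0 : T -> C) (L : T -> {set C}) (H : {set T}) :
    {in H &, forall u v, D u v -> side u != side v} ->
    {in H, forall v, #|[set w in H | D v w]| < #|L v|} ->
  exists2 c : T -> C, {in H, forall v, c v \in L v} &
    {in H &, forall u v, D u v -> c u != c v}.
Proof.
have [n] := ubnP #|H|; elim: n H L => // n IHn H L leHn bip outdeg.
have [->|/set0Pn[v0 v0H]] := eqVneq H set0.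
  by exists c0 => [v|u v]; rewrite inE.
have /card_gt0P[a aL] : 0 < #|L v0| by apply: leq_ltn_trans (outdeg _ v0H).
pose S := [set v in H | a \in L v].
have [u v /setIdP[uH _] /setIdP[vH _]|K /subsetP sKS [indK domK]] :=
  @bipartite_kernel T D side S; first exact: bip.
have sKH v : v \in K -> v \in H by move/sKS; rewrite inE => /andP[].
have /set0Pn[k kK] : K != set0.
  have [v0K|v0K] := boolP (v0 \in K); first by apply/set0Pn; exists v0.
  have [|v vK _] := domK v0; first by rewrite !inE v0K v0H.
  by apply/set0Pn; exists v.
have sH'H v : v \in H :\: K -> v \in H by rewrite inE => /andP[].
have [||v vH'|c cL cP] := IHn (H :\: K) (fun v => L v :\ a).
- apply: leq_trans (leHn : #|H| <= n); apply: proper_card; apply/properP; split; first exact: subsetDl.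
  by exists k; rewrite ?sKH // inE kK.
- by move=> u v /sH'H uH /sH'H; apply: bip.
- have vH := sH'H _ vH'; have := outdeg _ vH; rewrite (cardsD1 a (L v)).
  have [aLv|aLv] := boolP (a \in L v); last first.
    rewrite add0n; apply: leq_ltn_trans; apply: subset_leq_card.
    by apply/subsetP=> w; rewrite !inE => /andP[/andP[_ ->]].
  rewrite add1n ltnS; apply: leq_trans; apply: proper_card; apply/properP; split.
    by apply/subsetP=> w; rewrite !inE => /andP[/andP[_ ->]].
  have [|w wK vw] := domK v; first by move: vH'; rewrite !inE => /andP[-> ->].
  by exists w; rewrite !inE ?wK ?sKH.
exists (fun v => if v \in K then a else c v) => [v vH|u v uH vH uv].
  case: ifP => vK; first by have := sKS _ vK; rewrite inE => /andP[].
  by have := cL v; rewrite !inE vK vH => /(_ isT)/andP[].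
have cneq w : w \in H -> w \notin K -> c w != a.
  by move=> wH wK; have := cL w; rewrite !inE wK wH => /(_ isT)/andP[].
case: ifP => [uK|/negbT uK]; case: ifP => [vK|/negbT vK].
- by have := indK _ _ uK vK; rewrite uv.
- by rewrite eq_sym cneq.
- by rewrite cneq.
- by apply: cP; rewrite ?inE ?uK ?vK.
Qed.

Definition list_colorable (G : sgraph) (C : finType) (L : G -> {set C})
    (A : {set G}) : Prop :=
  exists2 c : G -> C, {in A, forall v, c v \in L v} &
    {in A &, forall u v, u -- v -> c u != c v}.

Definition deg_in (G : sgraph) (A : {set G}) (v : G) : nat :=
  #|[set w in A | v -- w]|.

(** Color [A :\: H] first and delete from each list on [H] the colors of the outer neighbors. By the
    bound on [deg_in], what remains is longer than the out-degree, and the kernel method colors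
    [H]. *)
Lemma list_colorable_extend (G : sgraph) (C : finType) (L : G -> {set C})
    (k : nat) (A H : {set G}) (side : pred G) (B : rel G) :
    (forall v, #|L v| = k.+1) -> H \subset A ->
    list_colorable L (A :\: H) ->
    {in H &, forall u v, u -- v -> side u != side v} ->
    (forall u v, B u v -> u -- v) -> (forall u v, B u v -> ~~ B v u) ->
    {in H, forall v, deg_in A v <= #|[set u in H | B u v]| + k} ->
  list_colorable L A.
Proof.
move=> cardL /subsetP sHA [c1 c1L c1P] bip BE Banti indeg.
(* Edges that are not arcs of B are oriented both ways, so that the out-degree
   of v is its degree in H minus its in-degree in B. *)
pose D u v := (u -- v) && ~~ B v u.
pose N v := [set w in A :\: H | v -- w].
have DH v : #|[set w in H | D v w]| + #|[set u in H | B u v]| = #|[set w in H | v -- w]|.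
  rewrite -(cardsID [set u in H | B u v] [set w in H | v -- w]) addnC; congr (_ + _).
    apply: eq_card => w; rewrite !inE; case: (w \in H) => //=.
    by case Bw: (B w v); rewrite ?andbF // sedge_sym BE.
  by apply: eq_card => w; rewrite !inE /D; case: (w \in H); rewrite //= andbC.
have degA v : deg_in A v = #|[set w in H | v -- w]| + #|N v|.
  rewrite /deg_in -(cardsID H [set w in A | v -- w]); congr (_ + _); apply: eq_card => w.
    rewrite !inE; have [wH|] := boolP (w \in H); last by rewrite andbF.
    by rewrite sHA ?andbT.
  by rewrite !inE andbA.
pose L' v := L v :\: [set c1 w | w in N v].
have [||c2 c2L c2P] := @bipartite_list_coloring G C D side c1 L' H.
- by move=> u v uH vH /andP[uv _]; apply: bip.
- move=> v vH; have := indeg v vH; rewrite degA -DH => h.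
  have h2 := leq_imset_card c1 (N v).
  have h3 : k.+1 - #|N v| <= #|L' v|.
    rewrite cardsD cardL leq_sub2l //; apply: leq_trans h2.
    by apply: subset_leq_card; apply: subsetIr.
  apply: leq_trans h3; rewrite ltn_subRL ltnS -(leq_add2r #|[set u in H | B u v]|).
  by rewrite [k + _]addnC; apply: leq_trans h; rewrite -addnA addnC.
exists (fun v => if v \in H then c2 v else c1 v) => [v vA|u v uA vA uv].
  case: ifP => [/c2L|/negbT vH]; first by rewrite inE => /andP[].
  by apply: c1L; rewrite inE vH.
have cross x y : x \in H -> y \in A -> y \notin H -> x -- y -> c2 x != c1 y.
  move=> xH yA yH xy; have := c2L _ xH; rewrite inE => /andP[+ _].
  by apply: contraNneq => ->; apply: imset_f; rewrite !inE yH yA.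
case: ifP => [uH|/negbT uH]; case: ifP => [vH|/negbT vH].
- have [Buv|Buv] := boolP (B u v); last first.
    by rewrite eq_sym; apply: c2P => //; rewrite /D sedge_sym uv Buv.
  by apply: c2P; rewrite // /D uv Banti.
- exact: cross.
- by rewrite eq_sym cross // sedge_sym.
- by apply: c1P; rewrite // inE ?uH ?vH.
Qed.

(** * Genus of pairs of permutations *)

Section PermutationPairs.

Variable D : finType.
Implicit Types (e s p : {perm D}) (x y z w : D) (W : {set D}).

Definition linked e s : rel D := connect (relU (frel e) (frel s)).

Definition link_class e s x : {set D} := [set y | linked e s x y].

Definition link_classes e s : {set {set D}} := [set link_class e s x | x in D].

Lemma linked_sym e s : symmetric (linked e s).
Proof. by apply: relU_sym; apply: fconnect_sym; apply: perm_inj. Qed.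

Lemma linked_refl e s : reflexive (linked e s).
Proof. by move=> x; apply: connect0. Qed.

Lemma linked_trans e s : transitive (linked e s).
Proof. by move=> y x z; apply: connect_trans. Qed.

Lemma linked_l e s x : linked e s x (e x).
Proof. by apply: connect1; rewrite /= eqxx. Qed.

Lemma linked_r e s x : linked e s x (s x).
Proof. by apply: connect1; rewrite /= eqxx orbT. Qed.

Lemma linked_porbit e s x y : y \in porbit (e * s)%g x -> linked e s x y.
Proof.
case/porbitP=> n ->; elim: n => [|n IHn]; first by rewrite expg0 perm1 linked_refl.
rewrite expgSr permM permM; apply: linked_trans IHn _.
exact: linked_trans (linked_l _ _ _) (linked_r _ _ _).
Qed.

Lemma linked_sub e s (S : rel D) :
    reflexive S -> transitive S ->
    (forall x, S x (e x)) -> (forall x, S x (s x)) ->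
  forall x y, linked e s x y -> S x y.
Proof.
move=> Srefl Strans Se Ss x y /connectP[p]; elim: p x => [|z p IHp] x /=.
  by move=> _ ->.
by case/andP=> /orP[]/eqP<- pz lp; apply: Strans (IHp _ pz lp).
Qed.

Lemma link_class_eq e s x y : (link_class e s x == link_class e s y) = linked e s x y.
Proof.
apply/eqP/idP => [/setP/(_ y)|xy]; first by rewrite !inE linked_refl.
by apply/setP=> z; rewrite !inE /linked (same_connect (@linked_sym e s) xy).
Qed.

(* V + F >= E + 2C for the hypermap (e, s).  The genus is never negative, so this
   is an equality, but the inequality is all that is needed. *)
Definition planar_perms e s : Prop :=
  #|D| + 2 * #|link_classes e s| <=
    #|porbits e| + #|porbits s| + #|porbits (e * s)%g|.

(** If [x] and [y] are still linked, each step of [e] stays inside a class of [e'], so the old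
    classes map onto the new ones. Otherwise only the new classes of [x] and [y] can come from a
    single old class. *)
Lemma card_link_classes_split e s x y (e' := (tperm x y * e)%g) :
  #|link_classes e' s| <= #|link_classes e s| + ~~ linked e' s x y.
Proof.
have step a : e a = e' (tperm x y a) by rewrite permM tpermK.
(* From an old class, [g] picks an element outside the new class of [y] if there is one, so that it
   hits every new class except possibly that of [y]. *)
pose g (B : {set D}) := if [pick z in B | ~~ linked e' s y z] is Some z
  then link_class e' s z else link_class e' s y.
have [xy|xy] := boolP (linked e' s x y).
  rewrite addn0; pose h (B : {set D}) := if [pick z in B] is Some z
    then link_class e' s z else set0.
  apply: leq_trans (leq_imset_card h _); apply: subset_leq_card.
  apply/subsetP=> _ /imsetP[w _ ->]; apply/imsetP; exists (link_class e s w).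
    exact: imset_f.
  rewrite /h; case: pickP => [z|/(_ w)]; last by rewrite inE linked_refl.
  rewrite inE => wz; apply/eqP; rewrite link_class_eq; move: w z wz.
  apply: linked_sub; [exact: linked_refl|exact: linked_trans| |exact: linked_r].
  move=> a; rewrite step; case: tpermP => [->|->|_ _]; last exact: linked_l.
    exact: linked_trans xy (linked_l _ _ _).
  by apply: linked_trans (linked_l _ _ _); rewrite linked_sym.
(* [S] is linking for [e'] with the classes of [x] and [y] merged; it contains linking for [e]. *)
pose S a b := linked e' s a b ||
  (linked e' s x a || linked e' s y a) && (linked e' s x b || linked e' s y b).
have eS a b : linked e s a b -> S a b.
  move: a b; apply: linked_sub.
  - by move=> a; rewrite /S linked_refl.
  - move=> b a c; rewrite /S => /orP[ab|/andP[-> bb]] /orP[bc|/andP[bb' ->]].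
    + by rewrite (linked_trans ab bc).
    + rewrite andbT; apply/orP; right; rewrite linked_sym in ab.
      by case/orP: bb' => h; rewrite (linked_trans h ab) ?orbT.
    + by case/orP: bb => h; rewrite (linked_trans h bc) ?orbT.
    + by rewrite orbT.
  - move=> a; rewrite /S step; case: tpermP => [->|->|_ _]; last by rewrite linked_l.
    + by rewrite linked_refl linked_l !orbT.
    + by rewrite linked_refl linked_l !orbT.
  - by move=> a; rewrite /S linked_r.
rewrite addn1; apply: leq_trans (_ : #|link_class e' s y |: g @: link_classes e s| <= _).
  apply: subset_leq_card; apply/subsetP=> _ /imsetP[w _ ->]; rewrite !inE.
  rewrite link_class_eq; case wy: (linked e' s w y) => //=.
  apply/imsetP; exists (link_class e s w); first exact: imset_f.
  rewrite /g; case: pickP => [z|/(_ w)]; last first.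
    by rewrite inE linked_refl linked_sym wy.
  rewrite inE => /andP[wz yz]; apply/eqP; rewrite link_class_eq.
  move: (eS _ _ wz); rewrite /S [linked _ _ y w]linked_sym wy (negbTE yz) !orbF.
  by case/orP=> // /andP[xw]; apply: linked_trans; rewrite linked_sym.
rewrite cardsU1; have := leq_imset_card g (link_classes e s).
by case: (_ \notin _) => /= h; rewrite ?add1n ?ltnS // ltnW.
Qed.

(* Splitting a cycle of e changes the number of cycles of e * s by one.  If it
   also splits a component, then x and y end up in different cycles of e * s, so
   that this number grows. *)
Lemma planar_perms_split e s x y :
    y \in porbit e x -> x != y -> planar_perms e s ->
  planar_perms (tperm x y * e)%g s.
Proof.
move=> exy neq_xy; rewrite /planar_perms; set e' := (tperm x y * e)%g; pose f := (e * s)%g.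
have eq_f' : (e' * s)%g = (tperm x y * f)%g by rewrite /e' -mulgA.
have le_classes : #|link_classes e' s| <= #|link_classes e s| + ~~ linked e' s x y :=
  card_link_classes_split e s x y.
have ce : #|porbits e'| + (x \notin porbit e y).*2 = #|porbits e| + (x != y) :=
  porbits_mul_tperm e x y.
have cf : #|porbits (e' * s)%g| + (x \notin porbit f y).*2 = #|porbits f| + (x != y).
  by rewrite eq_f'; apply: porbits_mul_tperm.
rewrite -/f; move: ce cf; rewrite porbit_sym exy neq_xy /= addn0 => -> cf.
move: le_classes; have [lxy|nxy] := boolP (linked e' s x y) => /=; first by lia.
have f_xy : x \notin porbit (e' * s)%g y.
  by apply: contra nxy; rewrite porbit_sym; apply: linked_porbit.
have : #|porbits (tperm x y * (e' * s))%g| + (x \notin porbit (e' * s)%g y).*2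
    = #|porbits (e' * s)%g| + (x != y) by apply: porbits_mul_tperm.
by rewrite {1}eq_f' mulgA tperm2 mul1g f_xy neq_xy /=; lia.
Qed.

(** The two products are conjugate: [q] carries the cycles of [q * p] to those of [p * q]. *)
Lemma card_porbits_mulC e s : #|porbits (e * s)%g| = #|porbits (s * e)%g|.
Proof.
suff le (p q : {perm D}) : #|porbits (p * q)%g| <= #|porbits (q * p)%g|.
  by apply/eqP; rewrite eqn_leq !le.
have := leq_imset_card (fun B : {set D} => [set q z | z in B]) (porbits (q * p)%g).
apply: leq_trans; apply: subset_leq_card; apply/subsetP=> _ /imsetP[x _ ->].
apply/imsetP; exists (porbit (q * p)%g ((q^-1)%g x)); first exact: imset_f.
have conj n y : ((p * q) ^+ n)%g (q y) = q (((q * p) ^+ n)%g y).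
  elim: n y => [|n IHn] y; first by rewrite !expg0 !perm1.
  by rewrite !expgS !permM IHn.
apply/setP=> z; apply/porbitP/imsetP => [[n ->]|[_ /porbitP[n ->] ->]].
  exists (((q * p) ^+ n)%g ((q^-1)%g x)); first exact: mem_porbit.
  by rewrite -conj permKV.
by exists n; rewrite -conj permKV.
Qed.

Lemma planar_perms_sym e s : planar_perms e s -> planar_perms s e.
Proof.
rewrite /planar_perms (card_porbits_mulC e s) [#|porbits e| + _]addnC.
suff -> : link_classes e s = link_classes s e by [].
apply: eq_imset => x; apply/setP=> y; rewrite !inE.
by apply: eq_connect => a b; rewrite /= orbC.
Qed.

(* [e] with [x] cut out of its cycle *)
Definition skip e x : {perm D} := (tperm x (e^-1 x) * e)%g.

Lemma skip_id e x : skip e x x = x.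
Proof. by rewrite permM tpermL permKV. Qed.

Lemma skipE e x z : z != x -> skip e x z = if e z == x then e x else e z.
Proof.
move=> zx; rewrite permM; case: eqP => [<-|ez]; first by rewrite permK tpermR.
rewrite tpermD 1?eq_sym //; apply: contra_not_neq ez => ->.
by rewrite permKV.
Qed.

Lemma porbit_fixed e x y : e x = x -> (x \in porbit e y) = (x == y).
Proof.
move=> ex; rewrite porbit_sym; apply/porbitP/eqP => [[n ->]|->].
  by elim: n => [|n IHn]; rewrite ?expg0 ?perm1 // expgS permM ex.
by exists 0; rewrite expg0 perm1.
Qed.

Lemma porbit_step e x y : (y \in porbit e (e x)) = (y \in porbit e x).
Proof.
by rewrite -[e x]/((e ^+ 1)%g x) porbit_perm.
Qed.

Lemma porbit_skip e x z : z != x -> porbit (skip e x) z = porbit e z :\ x.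
Proof.
move=> zx; apply/setP=> w; rewrite !inE; apply/idP/andP=> [h|[wx /porbitP[n w_n]]].
  split; first by apply: contraNneq zx => wx; move: h; rewrite wx porbit_fixed ?skip_id // eq_sym.
  case/porbitP: h => n ->; elim: n z zx => [|n IHn] z zx; first by rewrite expg0 perm1 porbit_id.
  have := zx; rewrite -(inj_eq (@perm_inj _ (skip e x))) skip_id => zx'.
  rewrite expgS permM -porbit_step; apply: subsetP (IHn _ zx').
  apply/subsetP=> u; rewrite skipE //; case: ifP => [/eqP ezx|_] //.
  by rewrite ezx porbit_step.
(* Strong induction on the exponent, because jumping over [x] takes two steps of [e]. *)
have [m] := ubnP n; elim: m n z zx w_n => // m IHm [|n] z zx w_n lenm.
  by rewrite w_n expg0 perm1 porbit_id.
rewrite -porbit_step skipE //; move: w_n; rewrite expgS permM.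
have [ezx|ezx] := eqVneq (e z) x; last by move=> wn; apply: IHm wn _.
rewrite ezx.
case: n lenm => [|n] lenm; first by rewrite expg0 perm1 => wE; rewrite wE eqxx in wx.
rewrite expgS permM => w_n; have ex : e x != x.
  by apply: contraNneq zx => exx; rewrite -(inj_eq (@perm_inj _ e)) ezx exx.
by apply: IHm w_n _; [|lia].
Qed.

Lemma planar_perms_skip e s x : planar_perms e s -> planar_perms (skip e x) s.
Proof.
have [ex|ex] := eqVneq x (e^-1 x)%g; first by rewrite /skip -ex tperm1 mul1g.
by apply: planar_perms_split => //; rewrite -porbitV (mem_porbit _ 1).
Qed.

(** The elements of [W] are cut out of their cycles one at a time, and each cut preserves the genus
    inequality. *)
Lemma planar_perms_restrict e s W : planar_perms e s ->
  exists2 e', planar_perms e' s &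
    {in W, forall x, e' x = x} /\ {in ~: W, forall x, porbit e' x = porbit e x :\: W}.
Proof.
move=> pl; suff [e' ple [e'1 e'2]] : exists2 e', planar_perms e' s &
    {in enum W, forall x, e' x = x} /\
    forall x, x \notin enum W -> porbit e' x = [set y in porbit e x | y \notin enum W].
  exists e' => //; split=> x; first by rewrite -mem_enum; apply: e'1.
  rewrite inE -mem_enum => /e'2 ->; apply/setP=> y.
  by rewrite !inE mem_enum andbC.
elim: (enum W) => [|w r [e' ple [e'1 e'2]]].
  by exists e => //; split=> // x _; apply/setP=> y; rewrite !inE andbT.
exists (skip e' w); first exact: planar_perms_skip.
split=> x; rewrite inE.
  have [-> _|xw /= /e'1 e'x] := eqVneq x w; first exact: skip_id.
  by rewrite skipE // e'x (negbTE xw).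
rewrite negb_or => /andP[xw /e'2 xr]; rewrite porbit_skip // xr.
by apply/setP=> y; rewrite !inE negb_or andbCA.
Qed.

Lemma perm_fixedC p W x : {in ~: W, forall y, p y = y} -> (p x \in W) = (x \in W).
Proof.
move=> fixp; have [xW|xW] := boolP (x \in W); last by rewrite fixp ?inE ?(negbTE xW).
apply: contraTT (xW) => pxW; have := fixp (p x); rewrite inE pxW => /(_ isT)/(@perm_inj _ p).
by move=> pxx; rewrite -pxx.
Qed.

Lemma porbit_sub_fixedC p W x :
  {in ~: W, forall y, p y = y} -> x \in W -> porbit p x \subset W.
Proof.
move=> fixp xW; apply/subsetP=> _ /porbitP[n ->].
by elim: n => [|n IHn]; rewrite ?expg0 ?perm1 // expgSr permM perm_fixedC.
Qed.

Lemma card_porbits_fixedC p W : {in ~: W, forall x, p x = x} ->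
  #|porbits p| = #|[set porbit p x | x in W]| + #|~: W|.
Proof.
move=> fixp; have -> : porbits p = [set porbit p x | x in W] :|: [set porbit p x | x in ~: W].
  by rewrite -imsetU setUCr; apply/setP=> B; apply/imsetP/imsetP=> -[x _ ->]; exists x.
rewrite cardsU (_ : _ :&: _ = set0) ?cards0 ?subn0.
  congr (_ + _); apply: card_in_imset => x y xW yW /eqP.
  rewrite eq_porbit_mem porbit_fixed ?fixp // => /eqP.
  by [].
apply/eqP; rewrite -subset0; apply/subsetP=> B.
rewrite inE => /andP[/imsetP[x xW ->] /imsetP[y yW /eqP]].
rewrite eq_sym eq_porbit_mem => yx.
by have := subsetP (porbit_sub_fixedC fixp xW) _ yx; move: yW; rewrite inE => /negbTE ->.
Qed.

Lemma linked_porbit_r e s x y : y \in porbit s x -> linked e s x y.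
Proof.
case/porbitP=> n ->; elim: n => [|n IHn]; first by rewrite expg0 perm1 linked_refl.
by rewrite expgSr permM; apply: linked_trans IHn (linked_r _ _ _).
Qed.

Lemma card_porbits_involution e W :
    {in ~: W, forall x, e x = x} -> {in W, forall x, e x != x} ->
    (forall x, e (e x) = x) ->
  2 * #|[set porbit e x | x in W]| = #|W|.
Proof.
move=> fixe e_neq ee.
have porbit_e x : porbit e x = [set x; e x].
  apply/setP=> y; rewrite !inE; apply/porbitP/idP => [[n ->]|].
    elim: n => [|n]; first by rewrite expg0 perm1 eqxx.
    by rewrite expgSr permM => /orP[]/eqP->; rewrite ?ee eqxx ?orbT.
  by case/orP=> /eqP->; [exists 0; rewrite expg0 perm1 | exists 1].
rewrite -[RHS]sum1_card (partition_big_imset (porbit e)) /= mulnC -sum_nat_const.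
apply: eq_bigr => _ /imsetP[x xW ->]; rewrite sum1dep_card.
have -> : [set i in W | porbit e i == porbit e x] = [set x; e x].
  apply/setP=> y; rewrite inE eq_porbit_mem porbit_e andbC.
  have [|//] := boolP (y \in [set x; e x]).
  by rewrite !inE => /orP[]/eqP->; rewrite ?perm_fixedC.
by rewrite cards2 eq_sym e_neq.
Qed.

(** A point outside [W] is a link class of its own and a cycle of each of [e], [s] and [e * s], so
    it cancels from the inequality. As [W] contains at least one class, V + F >= E + 2 is left, with
    E half of [#|W|]. *)
Lemma planar_perms_Euler e s W :
    planar_perms e s -> W != set0 ->
    {in ~: W, forall x, e x = x} -> {in ~: W, forall x, s x = x} ->
    {in W, forall x, e x != x} -> (forall x, e (e x) = x) ->
  #|W| + 4 <=
    2 * (#|[set porbit s x | x in W]| + #|[set porbit (e * s)%g x | x in W]|).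
Proof.
move=> pl /set0Pn[x0 x0W] fixe fixs e_neq ee.
have fixf : {in ~: W, forall x, (e * s)%g x = x}.
  by move=> x xW; rewrite permM fixe ?fixs.
have cardE := card_porbits_involution fixe e_neq ee.
have leC : #|~: W|.+1 <= #|link_classes e s|.
  have linkW x y : linked e s x y -> (x == y) || (x \in W) && (y \in W).
    move: x y; apply: linked_sub => [x|y x z|x|x]; first by rewrite eqxx.
    - case/orP=> [/eqP-> //|/andP[xW yW]] /orP[/eqP<-|/andP[_ zW]];
        by rewrite ?xW ?yW ?zW ?orbT.
    - by have [xW|xW] := boolP (x \in W); rewrite ?perm_fixedC ?xW ?orbT // fixe ?inE ?eqxx.
    - by have [xW|xW] := boolP (x \in W); rewrite ?perm_fixedC ?xW ?orbT // fixs ?inE ?eqxx.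
  have -> : #|~: W|.+1 = #|x0 |: ~: W| by rewrite cardsU1 !inE x0W.
  rewrite -(@card_in_imset _ _ (link_class e s)) => [|x y xW yW /eqP].
    by apply: subset_leq_card; apply/subsetP=> _ /imsetP[x _ ->]; apply: imset_f.
  rewrite link_class_eq => /linkW/orP[/eqP//|/andP[xW' yW']].
  by move: xW yW; rewrite !inE xW' yW' !orbF => /eqP-> /eqP->.
move: pl; rewrite /planar_perms !(@card_porbits_fixedC _ W) // -(cardsC W).
by lia.
Qed.

Lemma big_porbits (p : {perm D}) W (F : D -> nat) : {in ~: W, forall x, p x = x} ->
  \sum_(x in W) F x = \sum_(B in [set porbit p x | x in W]) \sum_(x in B) F x.
Proof.
move=> fixp; rewrite (partition_big_imset (porbit p)) /=.
apply: eq_bigr => _ /imsetP[x xW ->]; apply: eq_bigl => y; rewrite eq_porbit_mem andbC.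
have [yx|//] := boolP (y \in porbit p x).
exact: subsetP (porbit_sub_fixedC fixp xW) _ yx.
Qed.

End PermutationPairs.

(** It suffices to bound the number of link classes by [edge_components]. Darts with a common tail
    are linked through the rotation, and a dart is linked to its reverse, so a component carries at
    most one class. *)
Lemma planar_planar_perms (G : sgraph) (s : {perm dart G}) :
  rotation_system s -> genus_zero s -> planar_perms (rev_perm G) s.
Proof.
move=> rot genus.
have revE d : rev_perm G d = rev_dart d by rewrite permE.
have card_rev : 2 * #|porbits (rev_perm G)| = #|dart G|.
  have -> : porbits (rev_perm G) = [set porbit (rev_perm G) x | x in [set: dart G]].
    by apply/setP=> B; apply/imsetP/imsetP=> -[x _ ->]; exists x.
  rewrite card_porbits_involution ?cardsT // => [x|[[u v] uv] _|x].
  - by rewrite !inE.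
  - apply/eqP; rewrite revE => /(congr1 sval) /= [vu _].
    by move: uv; rewrite /= vu sedge_irrefl.
  - by rewrite !revE rev_dartK.
pose linkG := linked (rev_perm G) s.
have link_tail d d' : tail d = tail d' -> linkG d d'.
  by move=> tdd'; apply: linked_porbit_r; rewrite rot tdd'.
have link_connect d d' : connect sedge (tail d) (tail d') -> linkG d d'.
  case/connectP=> p; elim: p d => [|w p IHp] d /=; first by move=> _ /esym/link_tail.
  case/andP=> dw pw lp; pose d1 : dart G := exist _ (tail d, w) dw.
  apply: linked_trans (link_tail d d1 _) _; first by [].
  apply: linked_trans (linked_l _ _ d1) _; rewrite revE.
  exact: IHp.
pose h (d : dart G) := root sedge (tail d).
have symG : connect_sym (@sedge G) by apply: sym_connect_sym; apply: sedge_sym.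
have le_h : #|link_classes (rev_perm G) s| <= #|[set h d | d in dart G]|.
  pose g r := if [pick d | h d == r] is Some d then link_class (rev_perm G) s d else set0.
  apply: leq_trans (leq_imset_card g _); apply: subset_leq_card.
  apply/subsetP=> _ /imsetP[d _ ->]; apply/imsetP; exists (h d); first exact: imset_f.
  rewrite /g; case: pickP => [d'|/(_ d)]; last by rewrite eqxx.
  rewrite root_connect // => d'd; apply/eqP; rewrite link_class_eq.
  by rewrite linked_sym; apply: link_connect.
have le_ec : #|[set h d | d in dart G]| <= edge_components G.
  apply: subset_leq_card; apply/subsetP=> _ /imsetP[d _ ->]; rewrite !inE roots_root //=.
  have := connect_root sedge (tail d); rewrite symG -/(h d) => /connectP[[|w p] /=].
    by move=> _ <-; apply/existsP; exists (sval d).2; apply: (svalP d).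
  by case/andP=> hw _ _; apply/existsP; exists w.
move: genus; rewrite /genus_zero /planar_perms /face_perm; lia.
Qed.

(** * The map of an induced subgraph *)

Section InducedSubgraph.

Variables (G : sgraph) (A : {set G}).

Definition darts_in : {set dart G} :=
  [set d | ((sval d).1 \in A) && ((sval d).2 \in A)].

(** Delete the outer darts from [rev_perm] and then, by the symmetry of [planar_perms], from the
    rotation. Since [darts_in] is closed under reversal, this leaves the map induced on [A], with
    fixed points in place of the deleted darts. *)
Lemma planar_induced : planar G -> exists e s : {perm dart G},
  [/\ planar_perms e s,
      {in darts_in, forall d, e d = rev_dart d},
      {in darts_in, forall d, porbit s d = [set d' in darts_in | tail d' == tail d]},
      {in ~: darts_in, forall d, e d = d}
    & {in ~: darts_in, forall d, s d = d}].
Proof.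
case=> s0 rot /(planar_planar_perms rot) pl0.
have [e ple [e_out e_in]] := planar_perms_restrict (~: darts_in) pl0.
have [s pls [s_out s_in]] := planar_perms_restrict (~: darts_in) (planar_perms_sym ple).
exists e, s; split=> // [|d dA|d dA]; first exact: planar_perms_sym.
  have rdA : rev_dart d \in darts_in by move: dA; rewrite !inE andbC.
  have revE x : rev_perm G x = rev_dart x by rewrite permE.
  (* The restriction is known only through its orbits. An orbit consisting of [d] and [rev_dart d]
     leaves two values for [e d], and [d] itself would make it a singleton. *)
  have e_orb x : x \in darts_in -> e x = x \/ e x = rev_dart x.
    move=> xA; have : e x \in porbit e x by rewrite (mem_porbit e 1).
    rewrite e_in ?setCK // inE => /andP[_ /porbitP[n ->]].
    elim: n => [|n IHn]; first by left; rewrite expg0 perm1.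
    by rewrite expgSr permM; case: IHn => ->; rewrite revE ?rev_dartK; [right|left].
  case: (e_orb _ dA) => // ed; have: rev_dart d \in porbit e d.
    rewrite e_in ?setCK // inE inE negbK rdA /=.
    by rewrite -revE (mem_porbit _ 1).
  by rewrite porbit_sym porbit_fixed // => /eqP <-.
rewrite s_in ?setCK //; apply/setP=> d'; rewrite !inE negbK.
by congr (_ && _); rewrite rot.
Qed.

End InducedSubgraph.

(** * Discharging *)

Section Maps.

Variables (D : finType) (e s : {perm D}).
Let f : {perm D} := (e * s)%g.

Definition face_size (x : D) : nat := #|porbit f x|.

Definition vertex_size (x : D) : nat := #|porbit s x|.

(** A dart stands for a side of its face and for the corner at its tail; the face across the side
    [d] is that of [e d]. *)
Definition has_triangle_side (x : D) : bool :=
  [exists d in porbit f x, face_size (e d) == 3].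

(** At such a corner a vertex of degree 5 has to give the whole 1/3 to a 4-face, as no other corner
    can contribute. *)
Definition is_bad (x : D) : bool :=
  [&& face_size x == 4, has_triangle_side x, vertex_size x == 5,
      vertex_size (f x) <= 4, vertex_size (f (f x)) <= 4
    & vertex_size (f (f (f x))) <= 4].

Variable W : {set D}.
Hypothesis e_out : {in ~: W, forall d, e d = d}.
Hypothesis s_out : {in ~: W, forall d, s d = d}.
Hypothesis eK : forall d, e (e d) = d.

Lemma vertex_perm_in d : (s d \in W) = (d \in W).
Proof. exact: perm_fixedC. Qed.

Lemma edge_perm_in d : (e d \in W) = (d \in W).
Proof. exact: perm_fixedC. Qed.

Lemma face_perm_mapE d : f d = s (e d). Proof. exact: permM. Qed.

Lemma face_perm_in d : (f d \in W) = (d \in W).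
Proof. by rewrite face_perm_mapE vertex_perm_in edge_perm_in. Qed.

Lemma face_perm_edge d : f (e d) = s d.
Proof. by rewrite face_perm_mapE eK. Qed.

Lemma face_size_face_perm d : face_size (f d) = face_size d.
Proof. by rewrite /face_size -[f d]/((f ^+ 1)%g d) porbit_perm. Qed.

Lemma face_size_vertex_perm d : face_size (s d) = face_size (e d).
Proof. by rewrite -face_perm_edge face_size_face_perm. Qed.

Lemma iter_face_size d : iter (face_size d) f d = d.
Proof. exact: iter_porbit. Qed.

Lemma iter_vertex_perm_in i d : (iter i s d \in W) = (d \in W).
Proof. by elim: i => //= i IHi; rewrite vertex_perm_in. Qed.

End Maps.

(** * Final charges of faces and vertices *)

Section Discharging.

Variables (D : finType) (e s : {perm D}) (W : {set D}).
Let f : {perm D} := (e * s)%g.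
Local Notation len := (face_size e s).
Local Notation deg := (vertex_size s).
Local Notation triangle_side := (has_triangle_side e s).
Local Notation bad := (is_bad e s).
Implicit Types d x y : D.

Hypothesis e_out : {in ~: W, forall d, e d = d}.
Hypothesis s_out : {in ~: W, forall d, s d = d}.
Hypothesis eK : forall d, e (e d) = d.
Hypothesis len_gt2 : {in W, forall d, 2 < len d}.
Hypothesis deg_ge4 : {in W, forall d, 4 <= deg d}.
Hypothesis no_three_triangles : forall x, x \in W ->
  len x = 3 -> len (s x) = 3 -> len (s (s x)) = 3 -> False.
Hypothesis diamond_neighbors : forall y, y \in W ->
  len (s y) = 3 -> len (s (s y)) = 3 -> 5 < len y /\ 5 < len (s (s (s y))).
Hypothesis one_triangle_side : forall x, x \in W ->
    (len x == 4) || (len x == 5) -> len (e x) = 3 ->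
  len (e (f x)) <> 3 /\ len (e (f (f x))) <> 3.
Hypothesis quad_big_corner : forall x, x \in W -> len x = 4 -> triangle_side x ->
  exists2 d, d \in porbit f x & 4 < deg d.
Hypothesis bad_corners_not_adjacent : forall y, y \in W ->
  bad (s y) -> bad (s (s y)) -> False.
Hypothesis bad_corners_two_apart : forall y, y \in W ->
  bad (s y) -> bad (s (s (s y))) -> len (s (s y)) = 3.

Let s_in d : (s d \in W) = (d \in W) := vertex_perm_in s_out d.
Let fE d : f d = s (e d) := face_perm_mapE e s d.
Let len_s d : len (s d) = len (e d) := face_size_vertex_perm s eK d.
Let len_iter d : iter (len d) f d = d := iter_face_size e s d.
Let iter_s_in i d : (iter i s d \in W) = (d \in W) := iter_vertex_perm_in s_out i d.

Lemma sum_porbit (p : {perm D}) d (F : D -> nat) :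
  \sum_(x in porbit p d) F x = \sum_(x in porbit p d) F (p x).
Proof.
rewrite (reindex_inj (@perm_inj _ p)) /=; apply: eq_bigl => x.
by rewrite porbit_sym porbit_step porbit_sym.
Qed.

Lemma sum_porbit_traject (p : {perm D}) d (F : D -> nat) :
  \sum_(x in porbit p d) F x = \sum_(x <- traject p d #|porbit p d|) F x.
Proof.
by rewrite [RHS]big_uniq ?uniq_traject_porbit //=; apply: eq_bigl => x; rewrite porbit_traject.
Qed.

Definition tri x : bool := len x == 3.

(* What the vertex gives to the 4-face at its corner x, in units of 1/6. *)
Definition pay x : nat :=
  if [&& len x == 4, triangle_side x & 4 < deg x] then
    if [forall d in porbit f x, (4 < deg d) ==> (d == x)] then 2 else 1
  else 0.

(* What the corner x receives from its face and what it gives away, in units of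
   1/6; a corner of a triangle needs 1/6 for each of its two half-sides. *)
Definition gain x : nat :=
  if tri x then 0 else if 5 < len x then 2 else tri (s x) + tri ((s^-1)%g x).

Definition loss x : nat := if tri x then 2 else pay x.

Lemma len_porbit d x : x \in porbit f d -> len x = len d.
Proof. by rewrite -eq_porbit_mem /face_size => /eqP->. Qed.

Lemma deg_porbit d x : x \in porbit s d -> deg x = deg d.
Proof. by rewrite -eq_porbit_mem /vertex_size => /eqP->. Qed.

Lemma porbit_f_in d x : d \in W -> x \in porbit f d -> x \in W.
Proof.
move=> dW; apply/subsetP; apply: porbit_sub_fixedC dW => y yW.
by rewrite fE e_out // s_out.
Qed.

(** On a face with at most five sides, one of two triangle sides would follow the other after one or
    two steps, which [one_triangle_side] excludes. *)
Lemma card_triangle_sides d : d \in W -> (len d == 4) || (len d == 5) ->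
  \sum_(x in porbit f d) tri (s x) <= triangle_side d.
Proof.
move=> dW ld; have -> : \sum_(x in porbit f d) tri (s x) =
    #|[set x in porbit f d | len (e x) == 3]|.
  rewrite -sum1_card [RHS](eq_bigl (fun x => (x \in porbit f d) && tri (s x))).
    by rewrite big_mkcondr; apply: eq_bigr => x _; case: (tri _).
  by move=> x; rewrite inE /tri len_s.
have [/exists_inP[x0 x0d tx0]|/exists_inPn no_tri] := boolP (triangle_side d); last first.
  rewrite leqn0 cards_eq0; apply/eqP/setP=> x; rewrite !inE.
  by apply/negbTE/andP=> -[/no_tri/negP].
apply/card_le1P => x; rewrite !inE => /andP[xd /eqP tx] y; rewrite !inE.
have xW := porbit_f_in dW xd; rewrite -(len_porbit xd) in ld.
have -> : (y \in porbit f d) = (y \in porbit f x).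
  by move: xd; rewrite -eq_porbit_mem => /eqP->.
apply/andP/eqP=> [[]|->]; last by rewrite porbit_id tx.
rewrite porbit_traject -/(face_size e s x) => yx /eqP ty.
have [n1 n2] := one_triangle_side xW ld tx.
have yW : y \in W by apply: (porbit_f_in xW); rewrite porbit_traject.
have [m1 m2] : len (e (f y)) <> 3 /\ len (e (f (f y))) <> 3.
  apply: one_triangle_side => //; rewrite (@len_porbit x) //.
  by rewrite porbit_traject.
have := len_iter x; move: yx; case/orP: ld => /eqP-> /=; rewrite !inE.
  by case/or4P=> /eqP yE; rewrite yE in ty m1 m2 * => //= E; rewrite E in m1.
case/orP=> [/eqP->//|] /or4P[] /eqP yE; rewrite yE in ty m1 m2 * => //= E.
  by rewrite E in m2.
by rewrite E in m1.
Qed.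

(** Either a single big corner pays 2, or at least two of them pay 1 each. *)
Lemma pay_quad d : d \in W -> len d = 4 -> triangle_side d ->
  1 < \sum_(x in porbit f d) pay x.
Proof.
move=> dW l4 td; have [x xd bigx] := quad_big_corner dW l4 td.
have payE y : y \in porbit f d -> 4 < deg y -> pay y =
    if [forall z in porbit f d, (4 < deg z) ==> (z == y)] then 2 else 1.
  move=> yd bigy; rewrite /pay (len_porbit yd) l4 bigy eqxx.
  move: td yd; rewrite /has_triangle_side -eq_porbit_mem => + /eqP yd.
  by rewrite yd => -> /=.
rewrite (bigD1 x) //= payE //; case: ifP => [_|/negbT]; first by rewrite leq_addr.
rewrite negb_forall => /existsP[y]; rewrite !negb_imply => /and3P[yd bigy n_yx].
rewrite (bigD1 y) ?yd //= payE //; case: ifP => _; lia.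
Qed.

(** This is 6 (len - 4) - gain + loss >= 0 without subtraction. A triangle lacks 6 and receives 2
    per corner. A face of length at least 6 affords 2 per corner. A face of length 4 or 5 gives at
    most 2 in all, which a 4-face gets back from [pay_quad]. *)
Lemma face_charge d : d \in W ->
  \sum_(x in porbit f d) gain x + 24 <= 6 * len d + \sum_(x in porbit f d) loss x.
Proof.
move=> dW; have l3 := len_gt2 dW.
have [/eqP ld|n3] := boolP (len d == 3).
  rewrite [\sum_(_ in _) gain _]big1; last by move=> x /len_porbit; rewrite /gain /tri ld => ->.
  rewrite [\sum_(_ in _) loss _](eq_bigr (fun=> 2)).
    by rewrite sum_nat_const -/(face_size e s d) ld.
  by move=> x /len_porbit; rewrite /loss /tri ld => ->.
have [l6|l6] := boolP (5 < len d).
  rewrite [\sum_(_ in _) gain _](eq_bigr (fun=> 2)).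
    by rewrite sum_nat_const -/(face_size e s d); lia.
  by move=> x /len_porbit; rewrite /gain /tri => ->; rewrite (negbTE n3) l6.
have ld : (len d == 4) || (len d == 5) by lia.
rewrite [\sum_(_ in _) gain _](eq_bigr (fun x => tri (s x) + tri ((s^-1)%g x))); last first.
  by move=> x /len_porbit; rewrite /gain /tri => ->; rewrite (negbTE n3) (negbTE l6).
(* A triangle side counts at both of its ends; shifting by [f] identifies the two sums. *)
rewrite big_split /= [X in _ + X + 24]sum_porbit.
have -> : \sum_(x in porbit f d) tri ((s^-1)%g (f x)) = \sum_(x in porbit f d) tri (s x).
  by apply: eq_bigr => x _; rewrite fE permK /tri len_s.
have leS := card_triangle_sides dW ld.
apply: leq_trans (leq_add (leq_add leS leS) (leqnn 24)) _.
have [td|_] := boolP (triangle_side d); last by lia.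
rewrite [\sum_(_ in _) loss _](eq_bigr pay).
  by case/orP: ld => /eqP ld; [have := pay_quad dW ld td|]; lia.
by move=> x /len_porbit; rewrite /loss /tri => ->; rewrite (negbTE n3).
Qed.

Lemma pay_le2 x : pay x <= 2.
Proof. by rewrite /pay; do 2?case: ifP. Qed.

Lemma pay_tri x : tri x -> pay x = 0.
Proof. by rewrite /tri /pay => /eqP->. Qed.

Lemma pay_small x : deg x <= 4 -> pay x = 0.
Proof. by rewrite leqNgt /pay => /negbTE->; rewrite !andbF. Qed.

Lemma pay_bad x : x \in W -> deg x = 5 -> pay x = 2 -> bad x.
Proof.
move=> xW d5; rewrite /pay; case: ifP => // /and3P[l4 tx _].
case: ifP => // /forall_inP big _.
have small i : f (iter i f x) != x -> deg (f (iter i f x)) <= 4.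
  apply: contraNT; rewrite -ltnNge => /(implyP (big _ _)); apply.
  by rewrite -iterS -permX mem_porbit.
rewrite /is_bad l4 tx d5 eqxx /=.
have := uniq_traject_porbit f x; rewrite -/(face_size e s x) (eqP l4) /= !inE !negb_or.
case/andP=> /and3P[n1 n2 n3] _.
by apply/and3P; split; [apply: (small 0)|apply: (small 1)|apply: (small 2)]; rewrite /= eq_sym.
Qed.

(** Count each triangle corner once from each of its two neighbors. A neighbor that is not a
    triangle has it in its gain; otherwise the two form a consecutive pair, which is counted from
    both sides. *)
Lemma sum_gain d : 2 * \sum_(x in porbit s d) tri x <=
  \sum_(x in porbit s d) gain x + 2 * \sum_(x in porbit s d) (tri x && tri (s x)).
Proof.
have E1 : \sum_(x in porbit s d) (tri x && tri ((s^-1)%g x)) =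
    \sum_(x in porbit s d) (tri x && tri (s x)).
  by rewrite [LHS]sum_porbit; apply: eq_bigr => x _; rewrite permK andbC.
have E2 : \sum_(x in porbit s d) tri ((s^-1)%g x) = \sum_(x in porbit s d) tri x.
  by rewrite [LHS]sum_porbit; apply: eq_bigr => x _; rewrite permK.
have : \sum_(x in porbit s d) (tri (s x) + tri ((s^-1)%g x)) <=
    \sum_(x in porbit s d) (gain x + (tri x && tri (s x)) + (tri x && tri ((s^-1)%g x))).
  apply: leq_sum => x _; rewrite /gain.
  by case: (tri x) => /=; [|case: ifP => _]; case: (tri (s x)); case: (tri _).
by rewrite !big_split /= E1 E2 -(sum_porbit s d (fun x => nat_of_bool (tri x))) addnn -mul2n -addnA addnn -mul2n.
Qed.

Lemma vertex_charge d : d \in W ->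
  \sum_(x in porbit s d) loss x + 24 <= 6 * deg d + \sum_(x in porbit s d) gain x.
Proof.
move=> dW; have d4 := deg_ge4 dW.
have lossE : \sum_(x in porbit s d) loss x =
    2 * \sum_(x in porbit s d) tri x + \sum_(x in porbit s d) pay x.
  rewrite big_distrr -big_split; apply: eq_bigr => x _ /=.
  by rewrite /loss; case: ifP => [/pay_tri->|].
have inW i : iter i s d \in W by rewrite iter_s_in.
have dn_eq n : deg d = n -> iter n s d = d by move=> <-; apply: iter_porbit.
have deg_i i : deg (iter i s d) = deg d by apply: deg_porbit; rewrite -permX mem_porbit.
have [deg4|n4] := boolP (deg d == 4).
  have s4 := dn_eq _ (eqP deg4); rewrite /= in s4.
  have paid0 : \sum_(x in porbit s d) pay x = 0.
    by rewrite big1 // => x /deg_porbit dx; apply: pay_small; rewrite dx (eqP deg4).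
  (* A vertex of degree 4 has nothing to spend. Nontriangular neighbors cover the triangle corners,
     and two consecutive triangles are covered by the two large faces beside them. *)
  have fact y : y \in W ->
      tri (s y) && tri (s (s y)) ==> (5 < len y) && (5 < len (s (s (s y)))).
    by move=> yW; apply/implyP=> /andP[/eqP t1 /eqP t2]; apply/andP; apply: diamond_neighbors.
  have ntri y : (5 < len y) ==> ~~ tri y by apply/implyP; rewrite /tri; case: eqP => // ->.
  rewrite lossE paid0 !sum_porbit_traject -/(vertex_size s d) (eqP deg4) /= !big_cons !big_nil /gain.
  rewrite !permK -[(s^-1)%g d](_ : s (s (s d)) = _); last by rewrite -{2}s4 permK.
  have := fact _ (inW 0); have := fact _ (inW 1); have := fact _ (inW 2); have := fact _ (inW 3).
  have := ntri d; have := ntri (s d); have := ntri (s (s d)); have := ntri (s (s (s d))).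
  rewrite /= !s4.
  move: (tri d) (tri (s d)) (tri (s (s d))) (tri (s (s (s d)))).
  move: (5 < len d) (5 < len (s d)) (5 < len (s (s d))) (5 < len (s (s (s d)))).
  by do 8!case.
(* By [sum_gain] the needs of the triangles are covered up to 2 for each consecutive pair. *)
suff : 2 * \sum_(x in porbit s d) (tri x && tri (s x)) + \sum_(x in porbit s d) pay x + 24
    <= 6 * deg d.
  by have := sum_gain d; rewrite lossE; lia.
have [deg5|n5] := boolP (deg d == 5); last first.
  (* From degree 6 on, a cost of 2 per corner is affordable: 2 deg <= 6 deg - 24. *)
  have : \sum_(x in porbit s d) (2 * (tri x && tri (s x)) + pay x) <= \sum_(x in porbit s d) 2.
    apply: leq_sum => x _; case tx: (tri x) => /=; last by rewrite add0n pay_le2.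
    by rewrite pay_tri //; case: (tri _).
  rewrite big_split /= -big_distrr /= sum_nat_const -/(vertex_size s d); lia.
have s5 := dn_eq _ (eqP deg5); rewrite /= in s5.
(* Degree 5 leaves 6 to spend. At most one pair of triangles is consecutive. Two corners are always
   at cyclic distance 1 or 2, so two payments of 2 are possible only around a single triangle. *)
have fact3 y : y \in W -> ~~ [&& tri y, tri (s y) & tri (s (s y))].
  by move=> yW; apply/and3P=> -[/eqP t1 /eqP t2 /eqP t3]; apply: (no_three_triangles yW).
have fact_adj i : pay (iter i.+1 s d) = 2 -> pay (iter i.+2 s d) = 2 -> False.
  move=> p1 p2; apply: (bad_corners_not_adjacent (inW i));
  by apply: pay_bad; rewrite ?s_in ?inW // ?(deg_i i.+1) ?(deg_i i.+2) ?(eqP deg5).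
have fact_two i : pay (iter i.+1 s d) = 2 -> pay (iter i.+3 s d) = 2 -> tri (iter i.+2 s d).
  move=> p1 p2; apply/eqP; apply: (bad_corners_two_apart (inW i));
  by apply: pay_bad; rewrite ?s_in ?inW // ?(deg_i i.+1) ?(deg_i i.+3) ?(eqP deg5).
rewrite !sum_porbit_traject -/(vertex_size s d) (eqP deg5) /= !big_cons !big_nil.
have := fact_adj 0; have := fact_adj 1; have := fact_adj 2; have := fact_adj 3; have := fact_adj 4.
have := fact_two 0; have := fact_two 1; have := fact_two 2; have := fact_two 3; have := fact_two 4.
have := fact3 _ (inW 0); have := fact3 _ (inW 1); have := fact3 _ (inW 2).
have := fact3 _ (inW 3); have := fact3 _ (inW 4).
have := @pay_tri d; have := @pay_tri (s d); have := @pay_tri (s (s d)).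
have := @pay_tri (s (s (s d))); have := @pay_tri (s (s (s (s d)))).
have := pay_le2 d; have := pay_le2 (s d); have := pay_le2 (s (s d)).
have := pay_le2 (s (s (s d))); have := pay_le2 (s (s (s (s d)))).
rewrite /= !s5; clear.
move: (pay d) (pay (s d)) (pay (s (s d))) (pay (s (s (s d)))) (pay (s (s (s (s d))))).
move=> p0 p1 p2 p3 p4.
case: (tri d); case: (tri (s d)); case: (tri (s (s d))); case: (tri (s (s (s d))));
  case: (tri (s (s (s (s d))))) => //=; lia.
Qed.

Lemma sum_orbit_charge (p : {perm D}) (F H : D -> nat) :
    {in ~: W, forall x, p x = x} ->
    {in W, forall d, \sum_(x in porbit p d) F x + 24 <=
      6 * #|porbit p d| + \sum_(x in porbit p d) H x} ->
  \sum_(x in W) F x + 24 * #|[set porbit p x | x in W]| <=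
    6 * #|W| + \sum_(x in W) H x.
Proof.
move=> fixp charge; rewrite -[#|W|]sum1_card !(big_porbits _ fixp) [24 * _]mulnC -sum_nat_const.
rewrite big_distrr -!big_split /=; apply: leq_sum => _ /imsetP[d dW ->].
by rewrite sum1_card charge.
Qed.

(** Summed over all orbits, gain and loss cancel and 24 (V + F) <= 12 [#|W|] remains, whereas Euler
    gives 24 (V + F) >= 12 [#|W|] + 48. *)
Lemma discharging : {in W, forall x, e x != x} -> W != set0 -> ~ planar_perms e s.
Proof.
move=> e_neq W0 pl; have := planar_perms_Euler pl W0 e_out s_out e_neq eK.
have f_out : {in ~: W, forall x, f x = x}.
  by move=> x xW; rewrite fE e_out ?s_out.
have := sum_orbit_charge f_out face_charge.
have := sum_orbit_charge s_out vertex_charge.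
by rewrite -/f; lia.
Qed.

End Discharging.

(** * Cycles of length 3, 4 and 5 *)

Lemma neq_eqF (T : eqType) (x y : T) :
  x != y -> ((x == y) = false) * ((y == x) = false).
Proof. by move=> xy; rewrite [y == x]eq_sym (negbTE xy). Qed.

Section ShortCycles.

Variable G : sgraph.
Implicit Types a b c d e p q r t u v w x y : G.

Lemma sedge_neq u v : u -- v -> u != v.
Proof. by apply: contraTneq => ->; rewrite sedge_irrefl. Qed.

(** Used to tell triangles apart by their vertices, although distinctness of cycles is stated with
    edge sets. *)
Lemma cycle_edges_mem (s : seq G) v : (v \in s) = (v \in cover (cycle_edges s)).
Proof.
apply/idP/bigcupP => [vs|[_ /imsetP[x xs ->]]].
  exists [set v; next s v]; last by rewrite set21.
  by apply/imsetP; exists v.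
by rewrite !inE => /orP[]/eqP-> //; rewrite mem_next.
Qed.

Lemma edge_in_triangle a b r : a != b ->
  [set a; b] \in cycle_edges [:: a; b; r].
Proof.
move=> ab; apply/imsetP; exists a; first by rewrite inE eqxx.
by rewrite /= eqxx.
Qed.

Lemma kcycle3 a b r : a -- b -> r -- a -> r -- b -> kcycle 3 [:: a; b; r].
Proof.
move=> ab ra rb; split=> //; rewrite /ucycle /= ab ra sedge_sym rb /= !inE.
by rewrite negb_or (sedge_neq ab) ![_ == r]eq_sym (sedge_neq ra) (sedge_neq rb).
Qed.

Variables a b c d e : G.
Hypotheses (ab : a -- b) (bc : b -- c) (cd : c -- d) (de : d -- e) (ea : e -- a).
Hypotheses (n_ac : a != c) (n_ad : a != d) (n_bd : b != d) (n_be : b != e)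
  (n_ce : c != e).

Let C5 := [:: a; b; c; d; e].

Lemma kcycle5 : kcycle 5 C5.
Proof.
split=> //; rewrite /ucycle /= ab bc cd de ea /= !inE !negb_or.
rewrite n_ac n_ad n_bd n_be n_ce (sedge_neq ab) (sedge_neq bc) (sedge_neq cd).
by rewrite (sedge_neq de) eq_sym (sedge_neq ea).
Qed.

Lemma kcycle5_edges : [/\ [set a; b] \in cycle_edges C5,
  [set b; c] \in cycle_edges C5 & [set c; d] \in cycle_edges C5].
Proof.
split; apply/imsetP; [exists a|exists b|exists c]; rewrite ?inE ?eqxx ?orbT //=.
- by rewrite eqxx.
- by rewrite [b == a]eq_sym (negbTE (sedge_neq ab)) eqxx.
- by rewrite [c == a]eq_sym [c == b]eq_sym (negbTE n_ac) (negbTE (sedge_neq bc)) eqxx.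
Qed.

Hypothesis no_C5_two_C3 : ~ exists c t1 t2 : seq G,
     [/\ kcycle 5 c, kcycle 3 t1 & kcycle 3 t2] /\
     [/\ cycle_edges t1 <> cycle_edges t2,
         adjacent_cycles c t1 & adjacent_cycles c t2].

(** The triangles [a b r] and [b c t] have the same edges only if [r = c] and [t = a], when both are
    [a b c]. *)
Lemma no_consecutive_triangles r t :
  r -- a -> r -- b -> t -- b -> t -- c -> (r != c) || (t != a) -> False.
Proof.
move=> ra rb tb tc neq_rt; apply: no_C5_two_C3.
have [Eab Ebc _] := kcycle5_edges.
exists C5, [:: a; b; r], [:: b; c; t].
split; split; [exact: kcycle5|exact: kcycle3|exact: kcycle3| | |].
- move=> eqE; case/orP: neq_rt => [/negP|/negP]; apply.
    have: c \in [:: a; b; r] by rewrite cycle_edges_mem eqE -cycle_edges_mem !inE eqxx orbT.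
    rewrite !inE eq_sym (negbTE n_ac) eq_sym (negbTE (sedge_neq bc)) /=.
    by rewrite eq_sym.
  have: a \in [:: b; c; t] by rewrite cycle_edges_mem -eqE -cycle_edges_mem !inE eqxx.
  by rewrite !inE (negbTE n_ac) (negbTE (sedge_neq ab)) /= eq_sym.
- by exists [set a; b]; rewrite ?Eab ?edge_in_triangle ?sedge_neq.
- by exists [set b; c]; rewrite ?Ebc ?edge_in_triangle ?sedge_neq.
Qed.

(** The two triangles differ because one triangle cannot contain the four vertices [a], [b], [c],
    [d]. *)
Lemma no_opposite_triangles r t :
  r -- a -> r -- b -> t -- c -> t -- d -> False.
Proof.
move=> ra rb tc td; apply: no_C5_two_C3.
have [Eab _ Ecd] := kcycle5_edges.
exists C5, [:: a; b; r], [:: c; d; t].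
split; split; [exact: kcycle5|exact: kcycle3|exact: kcycle3| | |].
- move=> eqE.
  have: c \in [:: a; b; r] by rewrite cycle_edges_mem eqE -cycle_edges_mem !inE eqxx.
  have: d \in [:: a; b; r] by rewrite cycle_edges_mem eqE -cycle_edges_mem !inE eqxx orbT.
  rewrite !inE ![d == _]eq_sym ![c == _]eq_sym (negbTE n_ad) (negbTE n_bd) (negbTE n_ac).
  rewrite (negbTE (sedge_neq bc)) /= => /eqP-> /eqP dc.
  by move: cd; rewrite dc sedge_irrefl.
- by exists [set a; b]; rewrite ?Eab ?edge_in_triangle ?sedge_neq.
- by exists [set c; d]; rewrite ?Ecd ?edge_in_triangle ?sedge_neq.
Qed.

Hypothesis no_C5_chorded_C4 : ~ exists c q : seq G,
     [/\ kcycle 5 c, kcycle 4 q, has_chord q & adjacent_cycles c q].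

(** The 4-cycle [a b t r] has the chord [b r] and shares the side [a b] with the 5-cycle. *)
Lemma no_adjacent_diamond r t :
  r -- a -> r -- b -> t -- b -> t -- r -> t != a -> False.
Proof.
move=> ra rb tb tr n_ta; apply: no_C5_chorded_C4.
have [Eab _ _] := kcycle5_edges.
have n_ab := sedge_neq ab; have n_ra := sedge_neq ra; have n_rb := sedge_neq rb.
have n_tb := sedge_neq tb; have n_tr := sedge_neq tr.
pose neqs := (neq_eqF n_ab, neq_eqF n_ra, neq_eqF n_rb, neq_eqF n_tb, neq_eqF n_tr, neq_eqF n_ta).
exists C5, [:: a; b; t; r]; split; first exact: kcycle5.
- split=> //; rewrite /ucycle /= ab [b -- t]sedge_sym tb tr ra /= !inE.
  by rewrite !neqs.
- exists b, r; rewrite !inE !eqxx ?orbT; split=> //; first by rewrite sedge_sym.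
  apply/imsetP=> -[x]; rewrite !inE => /or4P[]/eqP->; rewrite /= ?neqs ?eqxx => /setP E.
  + by have := E a; rewrite !inE eqxx !neqs.
  + by have := E t; rewrite !inE eqxx !neqs.
  + by have := E t; rewrite !inE eqxx !neqs.
  + by have := E a; rewrite !inE eqxx !neqs.
- exists [set a; b] => //; apply/imsetP; exists a; rewrite ?inE ?eqxx //=.
  by rewrite eqxx.
Qed.

End ShortCycles.

Ltac adj := solve [assumption | rewrite sedge_sym; assumption].
Ltac adj_or_neq := solve [adj | rewrite eq_sym; assumption
  | apply: sedge_neq; adj | rewrite eq_sym; apply: sedge_neq; adj].

(** * Configurations of triangles and quadrilaterals that force a forbidden 5-cycle *)

Section Configurations.

Variable G : sgraph.
Hypothesis no_C5_two_C3 : ~ exists c t1 t2 : seq G,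
     [/\ kcycle 5 c, kcycle 3 t1 & kcycle 3 t2] /\
     [/\ cycle_edges t1 <> cycle_edges t2,
         adjacent_cycles c t1 & adjacent_cycles c t2].
Hypothesis no_C5_chorded_C4 : ~ exists c q : seq G,
     [/\ kcycle 5 c, kcycle 4 q, has_chord q & adjacent_cycles c q].
Implicit Types a b c d p q r t u v w x y z : G.

Let consecutive := fun a b c d e ab bc cd de ea n1 n2 n3 n4 n5 =>
  @no_consecutive_triangles G a b c d e ab bc cd de ea n1 n2 n3 n4 n5 no_C5_two_C3.
Let opposite := fun a b c d e ab bc cd de ea n1 n2 n3 n4 n5 =>
  @no_opposite_triangles G a b c d e ab bc cd de ea n1 n2 n3 n4 n5 no_C5_two_C3.

(** The path [u0 u1 u2 u3] closes through [v] to a 5-cycle whose first two sides lie in triangles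
    with apex [v]. *)
Lemma no_fan v u0 u1 u2 u3 :
    v -- u0 -> v -- u1 -> v -- u2 -> v -- u3 -> u0 -- u1 -> u1 -- u2 -> u2 -- u3 ->
  u0 != u2 -> u0 != u3 -> u1 != u3 -> False.
Proof.
move=> vu0 vu1 vu2 vu3 u01 u12 u23 n02 n03 n13.
by apply: (@consecutive u0 u1 u2 u3 v _ _ _ _ _ _ _ _ _ _ v v); try adj_or_neq; apply/orP; left; adj_or_neq.
Qed.

Section QuadTriangle.

Variables a b c d r : G.
Hypotheses (ab : a -- b) (bc : b -- c) (cd : c -- d) (da : d -- a).
Hypotheses (n_ac : a != c) (n_bd : b != d).
Hypotheses (ra : r -- a) (rb : r -- b) (n_rc : r != c) (n_rd : r != d).

(** Replacing the side [a b] by [a r b] gives the 5-cycle [r b c d a], which already meets the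
    triangle [a b r]. All lemmas of this section find a second triangle on this cycle. *)
Lemma quad_triangle_next t : t -- b -> t -- c -> False.
Proof.
move=> tb tc; apply: (@consecutive r b c d a _ _ _ _ _ _ _ _ _ _ a t); try adj_or_neq.
by rewrite n_ac.
Qed.

Lemma quad_triangle_opposite t : t -- c -> t -- d -> False.
Proof. by move=> tc td; apply: (@opposite r b c d a _ _ _ _ _ _ _ _ _ _ a t); adj_or_neq. Qed.

Lemma quad_triangle_chord1 : ~~ a -- c.
Proof. by apply/negP=> ac; apply: (@quad_triangle_next a); adj. Qed.

Lemma quad_triangle_chord2 : ~~ b -- d.
Proof. by apply/negP=> bd; apply: (@quad_triangle_next d); adj. Qed.

Lemma quad_triangle_diamond t : t -- r -> t -- a -> t != b -> False.
Proof.
move=> tr ta tb; apply: (@consecutive b r a d c _ _ _ _ _ _ _ _ _ _ a t); try adj_or_neq.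
by rewrite tb orbT.
Qed.

Lemma quad_triangle_diamond' t : t -- r -> t -- b -> t != a -> False.
Proof.
move=> tr tb ta; apply: (@consecutive a r b c d _ _ _ _ _ _ _ _ _ _ b t); try adj_or_neq.
by rewrite ta orbT.
Qed.

End QuadTriangle.

Section TwoQuads.

Variables v a y a' b y' b' : G.
Hypotheses (va : v -- a) (ay : a -- y) (ya' : y -- a') (a'v : a' -- v).
Hypotheses (vb : v -- b) (by' : b -- y') (y'b' : y' -- b') (b'v : b' -- v).
Hypotheses (n_vy : v != y) (n_aa' : a != a') (n_vy' : v != y') (n_bb' : b != b').

Definition has_apex p q := exists r, r -- p /\ r -- q.

(** An edge [a b] creates the triangle [v a b]. In the first three cases the other triangle has a
    side on [a b v a' y], the first quadrilateral with [v a] replaced by [v b a]. If it lies on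
    [v a], the cycle [b a v b' y'] serves instead. *)
Lemma no_cross_edge : a != b' -> b != a' -> ~~ v -- y -> ~~ v -- y' ->
    [\/ has_apex v a', has_apex a' y, has_apex y a
      | exists r, [/\ r -- v, r -- a & r != b]] ->
  ~~ a -- b.
Proof.
move=> n_ab' n_ba' N_vy N_vy' T; apply/negP=> ab.
have n_by : b != y by apply: contraNneq N_vy => <-.
have n_ay' : a != y' by apply: contraNneq N_vy' => <-.
case: T => -[r].
- by case=> rv ra'; apply: (@opposite a b v a' y _ _ _ _ _ _ _ _ _ _ v r); adj_or_neq.
- by case=> ra' ry; apply: (@opposite b a y a' v _ _ _ _ _ _ _ _ _ _ v r); try adj_or_neq.
- case=> ry ra; apply: (@consecutive b a y a' v _ _ _ _ _ _ _ _ _ _ v r); try adj_or_neq.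
  by rewrite n_vy.
- case=> rv ra n_rb; apply: (@consecutive b a v b' y' _ _ _ _ _ _ _ _ _ _ v r); try adj_or_neq.
  by rewrite n_rb orbT.
Qed.

(** An edge [y y'] closes the 5-cycle [v a y y' b], on which both given triangles have a side. *)
Lemma no_tip_edge : a != b -> ~~ v -- y -> ~~ v -- y' ->
    has_apex a y \/ (exists r, [/\ r -- v, r -- a & r != b]) ->
    has_apex b y' \/ has_apex v b ->
  ~~ y -- y'.
Proof.
move=> n_ab N_vy N_vy' T T'; apply/negP=> yy'.
have n_by : b != y by apply: contraNneq N_vy => <-.
have n_ay' : a != y' by apply: contraNneq N_vy' => <-.
case: T => -[r]; [case=> ra ry|case=> rv ra n_rb]; case: T' => -[r'] [r'1 r'2].
- by apply: (@opposite a y y' b v _ _ _ _ _ _ _ _ _ _ r r'); adj_or_neq.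
- by apply: (@opposite y a v b y' _ _ _ _ _ _ _ _ _ _ r r'); adj_or_neq.
- by apply: (@opposite a v b y' y _ _ _ _ _ _ _ _ _ _ r r'); adj_or_neq.
- apply: (@consecutive b v a y y' _ _ _ _ _ _ _ _ _ _ r' r); try adj_or_neq.
  by rewrite n_rb orbT.
Qed.

End TwoQuads.

Section SharedSpoke.

Variables v p y q y' q' : G.
Hypotheses (vp : v -- p) (py : p -- y) (yq : y -- q) (qv : q -- v).
Hypotheses (qy' : q -- y') (y'q' : y' -- q') (q'v : q' -- v).
Hypotheses (n_vy : v != y) (n_pq : p != q) (n_vy' : v != y') (n_qq' : q != q').

(** An edge [y y'] creates the triangle [q y y']. A triangle on [v p] or [p y] meets the 5-cycle
    [y' y p v q], and one on [y q] meets [y' y q v q']. *)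
Lemma no_tip_edge_shared : ~~ v -- y -> ~~ v -- y' ->
    [\/ has_apex v p, has_apex p y | exists r, [/\ r -- y, r -- q & r != y']] ->
  ~~ y -- y'.
Proof.
move=> N_vy N_vy' T; apply/negP=> yy'.
have n_py' : p != y' by apply: contraNneq N_vy' => <-.
have n_q'y : q' != y by apply: contraNneq N_vy => <-; rewrite sedge_sym.
case: T => -[r].
- by case=> rv rp; apply: (@opposite y' y p v q _ _ _ _ _ _ _ _ _ _ q r); adj_or_neq.
- case=> rp ry; apply: (@consecutive y' y p v q _ _ _ _ _ _ _ _ _ _ q r); try adj_or_neq.
  by rewrite [q == p]eq_sym n_pq.
- case=> ry rq n_ry'; apply: (@consecutive y' y q v q' _ _ _ _ _ _ _ _ _ _ q r); try adj_or_neq.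
  by rewrite n_ry' orbT.
Qed.

End SharedSpoke.

End Configurations.

(** * Reducible configurations *)

Lemma nonadjF (G : sgraph) (u v : G) :
  ~~ u -- v -> ((u -- v) = false) * ((v -- u) = false).
Proof. by move=> uv; rewrite [v -- u]sedge_sym (negbTE uv). Qed.

Section Critical.

Variables (G : sgraph) (C : finType) (L : G -> {set C}) (A : {set G}).
Hypothesis cardL : forall v, #|L v| = 4.
Hypothesis uncolorable : ~ list_colorable L A.
Hypothesis critical : forall B : {set G}, B \proper A -> list_colorable L B.

(** [X] and [Y] are the two sides of a bipartite configuration, and [arcs] lists its oriented edges.
    The rest of [A] is colorable by minimality, and [list_colorable_extend] applies with [k = 3]. *)
Lemma critical_irreducible (X Y : seq G) (arcs : seq (G * G)) :
    {subset X ++ Y <= A} -> 0 < size (X ++ Y) ->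
    all2rel (fun u w => ~~ u -- w) X -> all2rel (fun u w => ~~ u -- w) Y ->
    all (fun uw => uw.1 -- uw.2) arcs ->
    all (fun uw => (uw.2, uw.1) \notin arcs) arcs ->
    {in X ++ Y, forall w,
      deg_in A w <= #|[set u in X ++ Y | (u, w) \in arcs]| + 3} ->
  False.
Proof.
move=> sub ne; have [z zXY] : exists z, z \in X ++ Y.
  by case: (X ++ Y) ne => // z r _; exists z; rewrite mem_head.
move=> stabX stabY edges anti indeg; apply: uncolorable.
apply: (@list_colorable_extend G C L 3 A [set u in X ++ Y] (mem X)
  (fun u w => (u, w) \in arcs)) => //.
- by apply/subsetP=> u; rewrite inE => /sub.
- apply: critical; apply/properP; split; first exact: subsetDl.
  by exists z; [exact: sub|rewrite !inE negb_and negbK zXY].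
- move=> u w; rewrite !inE !mem_cat /=.
  have [uX _|_ /= uY] := boolP (u \in X); have [wX _|_ /= wY] := boolP (w \in X) => //.
    by rewrite (negbTE (allrelP stabX _ _ uX wX)).
  by rewrite (negbTE (allrelP stabY _ _ uY wY)).
- by move=> u w /(allP edges).
- by move=> u w /(allP anti).
move=> w; rewrite inE => /indeg h; apply: leq_trans h _; rewrite leq_add2r.
by apply: subset_leq_card; apply/subsetP=> u; rewrite !inE.
Qed.

Lemma critical_deg v : v \in A -> 4 <= deg_in A v.
Proof.
move=> vA; rewrite leqNgt; apply/negP=> deg_v.
apply: (@critical_irreducible [:: v] [::] [::]) => //= [u||u].
- by rewrite inE => /eqP->.
- by rewrite /allrel /= sedge_irrefl.
- by rewrite inE => /eqP->; apply: leq_trans (deg_v : _ <= 3) _; apply: leq_addl.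
Qed.

Lemma card_arcs1 (s : seq G) (arcs : seq (G * G)) u w :
  u \in s -> (u, w) \in arcs -> 0 < #|[set u in s | (u, w) \in arcs]|.
Proof. by move=> us uw; apply/card_gt0P; exists u; rewrite inE us. Qed.

Lemma card_arcs2 (s : seq G) (arcs : seq (G * G)) u u' w :
    u != u' -> u \in s -> u' \in s -> (u, w) \in arcs -> (u', w) \in arcs ->
  1 < #|[set u in s | (u, w) \in arcs]|.
Proof.
by move=> neq us u's uw u'w; apply/card_gt1P; exists u, u'; rewrite !inE us u's.
Qed.

Section Quad.

Variables a b c d : G.
Hypotheses (ab : a -- b) (bc : b -- c) (cd : c -- d) (da : d -- a).
Hypotheses (N_ac : ~~ a -- c) (N_bd : ~~ b -- d) (n_ac : a != c) (n_bd : b != d).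

Lemma critical_quad :
    {subset [:: a; b; c; d] <= A} ->
  exists2 v, v \in [:: a; b; c; d] & 4 < deg_in A v.
Proof.
move=> sub; apply/hasP; apply: contraT => /hasPn deg4; exfalso.
pose neqs := (neq_eqF n_ac, neq_eqF n_bd, neq_eqF (sedge_neq ab), neq_eqF (sedge_neq bc),
  neq_eqF (sedge_neq cd), neq_eqF (sedge_neq da)).
pose nadjs := (nonadjF N_ac, nonadjF N_bd, @sedge_irrefl G).
apply: (@critical_irreducible [:: a; c] [:: b; d] [:: (a, b); (b, c); (c, d); (d, a)]) => //=.
- move=> u uH; apply: sub; move: uH; rewrite !inE.
  by case/or4P=> ->; rewrite ?orbT.
- by rewrite /allrel /= !nadjs.
- by rewrite /allrel /= !nadjs.
- by rewrite ab bc cd da.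
- by rewrite !inE !xpair_eqE !neqs ?andbF.
move=> w wH; have degw : deg_in A w <= 4.
  by rewrite leqNgt; apply: deg4; move: wH; rewrite !inE => /or4P[]->; rewrite ?orbT.
apply: leq_trans degw _; rewrite -[4]/(1 + 3) leq_add2r.
move: wH; rewrite !inE => /or4P[]/eqP->.
- by apply: (@card_arcs1 _ _ d); rewrite !inE ?eqxx ?orbT.
- by apply: (@card_arcs1 _ _ b); rewrite !inE ?eqxx ?orbT.
- by apply: (@card_arcs1 _ _ a); rewrite !inE ?eqxx ?orbT.
- by apply: (@card_arcs1 _ _ c); rewrite !inE ?eqxx ?orbT.
Qed.

End Quad.

(** Orienting both 4-cycles cyclically gives in-degree 2 at [v] and at least 1 elsewhere. The tips
    [y] and [y'] may coincide. *)
Lemma critical_two_quads v p y q p' y' q' :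
    {subset [:: v; p; y; q; p'; y'; q'] <= A} ->
    v -- p -> p -- y -> y -- q -> q -- v ->
    v -- p' -> p' -- y' -> y' -- q' -> q' -- v ->
    all2rel (fun u w => ~~ u -- w) [:: v; y; y'] ->
    all2rel (fun u w => ~~ u -- w) [:: p; q; p'; q'] ->
    uniq [:: p; q; p'; q'] -> v != y -> v != y' ->
    deg_in A v <= 5 -> {in [:: p; y; q; p'; y'; q'], forall w, deg_in A w <= 4} ->
  False.
Proof.
move=> sub vp py yq qv vp' p'y' y'q' q'v stabX stabY uniqY n_vy n_vy' deg_v deg4.
move: uniqY; rewrite /= !inE !negb_or -!andbA.
case/and5P=> n_pq n_pp' n_pq' n_qp' /and3P[n_qq' n_p'q' _].
have N_vy : ~~ v -- y by apply: (allrelP stabX); rewrite !inE eqxx ?orbT.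
have n_p'y : p' != y by apply: contraNneq N_vy => <-.
have n_q'y : q' != y by apply: contraNneq N_vy => <-; rewrite sedge_sym.
pose neqs := (neq_eqF n_p'y, neq_eqF n_q'y, neq_eqF n_pq, neq_eqF n_pp', neq_eqF n_pq', neq_eqF n_qp', neq_eqF n_qq',
  neq_eqF n_p'q', neq_eqF n_vy, neq_eqF n_vy', neq_eqF (sedge_neq vp),
  neq_eqF (sedge_neq py), neq_eqF (sedge_neq yq), neq_eqF (sedge_neq qv),
  neq_eqF (sedge_neq vp'), neq_eqF (sedge_neq p'y'), neq_eqF (sedge_neq y'q'),
  neq_eqF (sedge_neq q'v)).
apply: (@critical_irreducible [:: v; y; y'] [:: p; q; p'; q']
  [:: (v, p); (p, y); (y, q); (q, v); (v, p'); (p', y'); (y', q'); (q', v)]) => //=.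
- move=> u uH; apply: sub; move: uH; rewrite !inE.
  by do 6?[case/orP]; move=> ->; rewrite ?orbT.
- by rewrite vp py yq qv vp' p'y' y'q' q'v.
- by rewrite !inE !xpair_eqE !neqs ?andbF.
move=> w; rewrite !inE => /orP[/eqP->|].
  apply: leq_trans deg_v _; rewrite -[5]/(2 + 3) leq_add2r.
  by apply: (@card_arcs2 _ _ q q'); rewrite ?inE ?eqxx ?orbT.
move=> wH; have degw : deg_in A w <= 4.
  by apply: deg4; move: wH; rewrite ?inE; do 5?[case/orP]; move=> ->; rewrite ?orbT.
apply: leq_trans degw _; rewrite -[4]/(1 + 3) leq_add2r.
move: wH; do 5?[case/orP]; move=> /eqP->.
- by apply: (@card_arcs1 _ _ p); rewrite !inE ?eqxx ?orbT.
- by apply: (@card_arcs1 _ _ p'); rewrite !inE ?eqxx ?orbT.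
- by apply: (@card_arcs1 _ _ v); rewrite !inE ?eqxx ?orbT.
- by apply: (@card_arcs1 _ _ y); rewrite !inE ?eqxx ?orbT.
- by apply: (@card_arcs1 _ _ v); rewrite !inE ?eqxx ?orbT.
- by apply: (@card_arcs1 _ _ y'); rewrite !inE ?eqxx ?orbT.
Qed.

(** Both 4-cycles are oriented through the shared spoke from [v] to [q]. Then [v] is entered from
    [p] and from [q'], and every other vertex at least once. *)
Lemma critical_shared_spoke v p y q y' q' :
    {subset [:: v; p; y; q; y'; q'] <= A} ->
    v -- p -> p -- y -> y -- q -> q -- v ->
    q -- y' -> y' -- q' -> q' -- v ->
    all2rel (fun u w => ~~ u -- w) [:: v; y; y'] ->
    all2rel (fun u w => ~~ u -- w) [:: p; q; q'] ->
    uniq [:: p; q; q'] -> v != y -> v != y' ->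
    deg_in A v <= 5 -> {in [:: p; y; q; y'; q'], forall w, deg_in A w <= 4} ->
  False.
Proof.
move=> sub vp py yq qv qy' y'q' q'v stabX stabY uniqY n_vy n_vy' deg_v deg4.
move: uniqY; rewrite /= !inE !negb_or -!andbA.
case/and4P=> n_pq n_pq' n_qq' _.
have N_vy : ~~ v -- y by apply: (allrelP stabX); rewrite !inE eqxx ?orbT.
have n_q'y : q' != y by apply: contraNneq N_vy => <-; rewrite sedge_sym.
pose neqs := (neq_eqF n_q'y, neq_eqF n_pq, neq_eqF n_pq', neq_eqF n_qq',
  neq_eqF n_vy, neq_eqF n_vy', neq_eqF (sedge_neq vp),
  neq_eqF (sedge_neq py), neq_eqF (sedge_neq yq), neq_eqF (sedge_neq qv),
  neq_eqF (sedge_neq qy'), neq_eqF (sedge_neq y'q'), neq_eqF (sedge_neq q'v)).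
apply: (@critical_irreducible [:: v; y; y'] [:: p; q; q']
  [:: (p, v); (q', v); (v, q); (q, y); (y, p); (q, y'); (y', q')]) => //=.
- move=> u uH; apply: sub; move: uH; rewrite !inE.
  by do 5?[case/orP]; move=> ->; rewrite ?orbT.
- by rewrite [p -- v]sedge_sym vp q'v [v -- q]sedge_sym qv [q -- y]sedge_sym yq
    [y -- p]sedge_sym py qy' y'q'.
- by rewrite !inE !xpair_eqE !neqs ?andbF.
move=> w; rewrite !inE => /orP[/eqP->|].
  apply: leq_trans deg_v _; rewrite -[5]/(2 + 3) leq_add2r.
  by apply: (@card_arcs2 _ _ p q'); rewrite ?inE ?eqxx ?orbT.
move=> wH; have degw : deg_in A w <= 4.
  by apply: deg4; move: wH; rewrite ?inE; do 4?[case/orP]; move=> ->; rewrite ?orbT.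
apply: leq_trans degw _; rewrite -[4]/(1 + 3) leq_add2r.
move: wH; do 4?[case/orP]; move=> /eqP->.
- by apply: (@card_arcs1 _ _ q); rewrite !inE ?eqxx ?orbT.
- by apply: (@card_arcs1 _ _ q); rewrite !inE ?eqxx ?orbT.
- by apply: (@card_arcs1 _ _ y); rewrite !inE ?eqxx ?orbT.
- by apply: (@card_arcs1 _ _ v); rewrite !inE ?eqxx ?orbT.
- by apply: (@card_arcs1 _ _ y'); rewrite !inE ?eqxx ?orbT.
Qed.

End Critical.

(** * Faces of the induced map *)

Section LocalStructure.

Variables (G : sgraph) (A : {set G}) (e s : {perm dart G}).
Let W := darts_in A.
Hypothesis e_rev : {in W, forall d, e d = rev_dart d}.
Hypothesis s_rot : {in W, forall d, porbit s d = [set d' in W | tail d' == tail d]}.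
Hypothesis e_out : {in ~: W, forall d, e d = d}.
Hypothesis s_out : {in ~: W, forall d, s d = d}.
Hypothesis mindeg : {in A, forall v, 4 <= deg_in A v}.

Definition dst (d : dart G) : G := (sval d).2.
Let f : {perm dart G} := (e * s)%g.
Local Notation len := (face_size e s).
Local Notation deg := (vertex_size s).
Local Notation triangle_side := (has_triangle_side e s).
Local Notation bad := (is_bad e s).

Implicit Types d x y : dart G.

Lemma edge_dart d : tail d -- dst d.
Proof. exact: (svalP d). Qed.

Lemma dart_inj d d' : tail d = tail d' -> dst d = dst d' -> d = d'.
Proof.
by case: d => [[u v] uv]; case: d' => [[u' v'] uv'] /= ? ?; apply: val_inj; congr pair.
Qed.

Let s_in d : (s d \in W) = (d \in W) := vertex_perm_in s_out d.
Let e_in d : (e d \in W) = (d \in W) := edge_perm_in e_out d.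
Let f_in d : (f d \in W) = (d \in W) := face_perm_in e_out s_out d.
Let fE d : f d = s (e d) := face_perm_mapE e s d.
Let len_f d : len (f d) = len d := face_size_face_perm e s d.
Let len_iter d : iter (len d) f d = d := iter_face_size e s d.
Let iter_s_in i d : (iter i s d \in W) = (d \in W) := iter_vertex_perm_in s_out i d.

Lemma tail_in d : d \in W -> tail d \in A.
Proof. by rewrite inE => /andP[]. Qed.

Lemma dst_in d : d \in W -> dst d \in A.
Proof. by rewrite inE => /andP[]. Qed.

Lemma tail_s d : d \in W -> tail (s d) = tail d.
Proof.
move=> dW; have : s d \in porbit s d by rewrite (mem_porbit s 1).
by rewrite s_rot // inE => /andP[_ /eqP].
Qed.

Lemma tail_e d : d \in W -> tail (e d) = dst d.
Proof. by move=> /e_rev->. Qed.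

Lemma dst_e d : d \in W -> dst (e d) = tail d.
Proof. by move=> /e_rev->. Qed.

Lemma eK d : e (e d) = d.
Proof.
have [dW|dW] := boolP (d \in W); last by rewrite !e_out ?in_setC.
by rewrite [e (e d)]e_rev ?e_in // e_rev // rev_dartK.
Qed.

Let f_e d : f (e d) = s d := face_perm_edge s eK d.
Let len_s d : len (s d) = len (e d) := face_size_vertex_perm s eK d.

Lemma tail_f d : d \in W -> tail (f d) = dst d.
Proof. by move=> dW; rewrite fE tail_s ?e_in // tail_e. Qed.

Lemma degE d : d \in W -> deg d = deg_in A (tail d).
Proof.
move=> dW; rewrite /vertex_size s_rot // -(@card_in_imset _ _ dst).
  apply: eq_card => w; rewrite !inE; apply/imsetP/andP=> [[d' ]|[wA dw]].
    by rewrite !inE => /andP[/andP[_ ?] /eqP<-] ->; rewrite edge_dart.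
  exists (exist _ (tail d, w) dw) => //.
  by rewrite !inE /= wA tail_in ?eqxx.
move=> x y; rewrite !inE => /andP[_ /eqP tx] /andP[_ /eqP ty].
by apply: dart_inj; rewrite tx ty.
Qed.

Lemma deg_ge4 d : d \in W -> 4 <= deg d.
Proof. by move=> dW; rewrite degE // mindeg // tail_in. Qed.

Lemma tail_iter_s i d : d \in W -> tail (iter i s d) = tail d.
Proof. by move=> dW; elim: i => //= i IHi; rewrite tail_s ?iter_s_in. Qed.

Lemma spoke_neq i j d : d \in W -> i < j < deg d ->
  dst (iter i s d) != dst (iter j s d).
Proof.
move=> dW /andP[ij jd]; apply/negP=> /eqP eqd.
have /eqP := dart_inj (etrans (tail_iter_s i dW) (esym (tail_iter_s j dW))) eqd.
have jt : j < size (traject s d (deg d)) by rewrite size_traject.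
have it : i < size (traject s d (deg d)) by apply: ltn_trans ij jt.
rewrite -!(nth_traject s _ d (n := deg d)) // ?(ltn_trans ij) //.
by rewrite nth_uniq ?uniq_traject_porbit // => /eqP ijE; rewrite ijE ltnn in ij.
Qed.

Lemma spoke_neq1 d : d \in W -> dst d != dst (s d).
Proof. by move=> dW; apply: (@spoke_neq 0 1) => //; have := deg_ge4 dW; lia. Qed.

Lemma spoke_neq2 d : d \in W -> dst d != dst (s (s d)).
Proof. by move=> dW; apply: (@spoke_neq 0 2) => //; have := deg_ge4 dW; lia. Qed.

Lemma spoke_neq3 d : d \in W -> dst d != dst (s (s (s d))).
Proof. by move=> dW; apply: (@spoke_neq 0 3) => //; have := deg_ge4 dW; lia. Qed.

(** [e d] and [f d] are consecutive spokes at the head of [d], so a face never turns straight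
    back. *)
Lemma dst_f_neq d : d \in W -> tail d != dst (f d).
Proof. by move=> dW; rewrite -dst_e // fE spoke_neq1 // e_in. Qed.

Lemma len_gt2 d : d \in W -> 2 < len d.
Proof.
move=> dW; have := len_iter d; case: (len d) (card_porbit_neq0 f d : len d != 0) => [//|[|[|//]]] _ /=.
  by move=> fd; have := edge_dart d; rewrite -tail_f // fd sedge_irrefl.
by move=> ffd; have := dst_f_neq dW; rewrite -tail_f ?f_in // ffd eqxx.
Qed.

(* The corner at x = s y lies between the spokes y and x. *)
Lemma last_side y n : len (s y) = n.+1 -> iter n f (s y) = e y.
Proof.
move=> l; apply: (@perm_inj _ f); rewrite f_e -iterS -l; exact: len_iter.
Qed.

Lemma triangle_corner y : y \in W -> len (s y) = 3 -> dst y -- dst (s y).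
Proof.
move=> yW /last_side /= ffE; have := edge_dart (f (s y)).
by rewrite -[dst (f _)]tail_f ?f_in ?s_in // ffE tail_f ?s_in // tail_e // sedge_sym.
Qed.

Lemma triangle_apex y : y \in W -> len (e y) = 3 ->
  [/\ dst (s y) -- tail y, dst (s y) -- dst y & dst (s y) != dst (f y)].
Proof.
move=> yW l; have l' : len (s y) = 3 by rewrite len_s.
split; first by rewrite sedge_sym -tail_s // edge_dart.
  by rewrite sedge_sym triangle_corner.
(* [u] is the spoke from [dst y] to the apex; [u], [e y] and [f y] are consecutive there. *)
pose u := e (f (f (e y))).
have uW : u \in W by rewrite e_in !f_in e_in.
have su : s u = e y by rewrite -fE; have := len_iter (e y); rewrite l.
rewrite fE -su; suff -> : dst (s y) = dst u by apply: spoke_neq2.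
by rewrite dst_e ?f_in ?e_in // tail_f ?f_in ?e_in // f_e.
Qed.

Lemma quad_face x (a := tail x) (b := dst x) (c := dst (f x)) (d := dst (f (f x))) :
    x \in W -> len x = 4 ->
  [/\ a -- b, b -- c, c -- d, d -- a & a != c /\ b != d] /\ dst (f (f (f x))) = a.
Proof.
move=> xW l; have E : f (f (f (f x))) = x by have := len_iter x; rewrite l.
have dE : dst (f (f (f x))) = a by rewrite -tail_f ?f_in // E.
split=> //; split.
- exact: edge_dart.
- by have := edge_dart (f x); rewrite tail_f.
- by have := edge_dart (f (f x)); rewrite tail_f ?f_in.
- by have := edge_dart (f (f (f x))); rewrite dE tail_f ?f_in.
split; first exact: dst_f_neq.
by have := dst_f_neq (_ : f x \in W); rewrite f_in tail_f //; apply.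
Qed.

Lemma pent_face x (a := tail x) (b := dst x) (c := dst (f x)) (d := dst (f (f x)))
    (g := dst (f (f (f x)))) :
    x \in W -> len x = 5 ->
  [/\ a -- b, b -- c, c -- d, d -- g & g -- a] /\
  [/\ a != c, a != d, b != d, b != g & c != g].
Proof.
move=> xW l; have E : f (f (f (f (f x)))) = x by have := len_iter x; rewrite l.
have dE : dst (f (f (f (f x)))) = a by rewrite -tail_f ?f_in // E.
split; split.
- exact: edge_dart.
- by have := edge_dart (f x); rewrite tail_f.
- by have := edge_dart (f (f x)); rewrite tail_f ?f_in.
- by have := edge_dart (f (f (f x))); rewrite tail_f ?f_in.
- by have := edge_dart (f (f (f (f x)))); rewrite dE tail_f ?f_in.
- exact: dst_f_neq.
- have := dst_f_neq (_ : f (f (f x)) \in W); rewrite !f_in => /(_ xW).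
  by rewrite dE tail_f ?f_in // eq_sym.
- by have := dst_f_neq (_ : f x \in W); rewrite f_in tail_f //; apply.
- have := dst_f_neq (_ : f (f (f (f x))) \in W); rewrite !f_in => /(_ xW).
  by rewrite E tail_f ?f_in // eq_sym.
- by have := dst_f_neq (_ : f (f x) \in W); rewrite !f_in tail_f ?f_in //; apply.
Qed.

Lemma quad_apex x : x \in W -> len x = 4 -> len (e x) = 3 ->
  let r := dst (s x) in
  [/\ r -- tail x, r -- dst x, r != dst (f x) & r != dst (f (f x))].
Proof.
move=> xW l4 l3 r; have [r1 r2 r3] := triangle_apex xW l3.
(* [y] is the spoke from [tail x] to the fourth vertex of the face; [y], [x] and [s x] are
   consecutive. *)
split=> //; pose y := e (f (f (f x))).
have yW : y \in W by rewrite e_in !f_in.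
have yx : s y = x by rewrite -fE; have := len_iter x; rewrite l4.
have -> : dst (f (f x)) = dst y by rewrite dst_e ?f_in // tail_f ?f_in.
by rewrite /r -yx eq_sym spoke_neq2.
Qed.

(** * Neighboring faces under the two conditions on 5-cycles *)

Hypothesis no_C5_two_C3 : ~ exists c t1 t2 : seq G,
     [/\ kcycle 5 c, kcycle 3 t1 & kcycle 3 t2] /\
     [/\ cycle_edges t1 <> cycle_edges t2,
         adjacent_cycles c t1 & adjacent_cycles c t2].
Hypothesis no_C5_chorded_C4 : ~ exists c q : seq G,
     [/\ kcycle 5 c, kcycle 4 q, has_chord q & adjacent_cycles c q].

Lemma no_three_triangles x : x \in W ->
  len x = 3 -> len (s x) = 3 -> len (s (s x)) = 3 -> False.
Proof.
move=> xW; pose y := (s^-1)%g x; have <- : s y = x by rewrite permKV.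
have yW : y \in W by rewrite -s_in permKV.
move=> /triangle_corner h1 /triangle_corner h2 /triangle_corner h3.
apply: (@no_fan G no_C5_two_C3 (tail y) (dst y) (dst (s y)) (dst (s (s y))) (dst (s (s (s y))))).
- exact: edge_dart.
- by rewrite -tail_s // edge_dart.
- by rewrite -tail_s // -tail_s ?s_in // edge_dart.
- by rewrite -tail_s // -tail_s ?s_in // -tail_s ?s_in // edge_dart.
- exact: h1.
- by apply: h2; rewrite s_in.
- by apply: h3; rewrite !s_in.
- exact: spoke_neq2.
- exact: spoke_neq3.
- by rewrite spoke_neq2 ?s_in.
Qed.

Lemma one_triangle_side x : x \in W -> (len x == 4) || (len x == 5) -> len (e x) = 3 ->
  len (e (f x)) <> 3 /\ len (e (f (f x))) <> 3.
Proof.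
move=> xW /orP[] /eqP lx l3.
  have [[ab bc cd da [n_ac n_bd]] _] := quad_face xW lx.
  have [ra rb rc rd] := quad_apex xW lx l3.
  split=> /triangle_apex[]; rewrite ?f_in // tail_f ?f_in // => t1 t2 _.
    exact: (@quad_triangle_next G no_C5_two_C3 _ _ _ _ _ ab bc cd da n_ac n_bd ra rb rc rd _ t1 t2).
  exact: (@quad_triangle_opposite G no_C5_two_C3 _ _ _ _ _ ab bc cd da n_ac n_bd ra rb rc rd _ t1 t2).
have [[ab bc cd dg ga] [n_ac n_ad n_bd n_bg n_cg]] := pent_face xW lx.
have [ra rb n_rc] := triangle_apex xW l3.
split=> /triangle_apex[]; rewrite ?f_in // tail_f ?f_in // => t1 t2 _.
  apply: (@no_consecutive_triangles G _ _ _ _ _ ab bc cd dg ga n_ac n_ad n_bd n_bg n_cg) ra rb t1 t2 _ => //.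
  by rewrite n_rc.
exact: (@no_opposite_triangles G _ _ _ _ _ ab bc cd dg ga n_ac n_ad n_bd n_bg n_cg) ra rb t1 t2.
Qed.

(** A 4-face and the triangle across [x] would form a 5-cycle meeting two triangles. A 5-face would
    share the side [x] with the chorded 4-cycle made of the two triangles. *)
Lemma face_across_diamond x t : x \in W -> len (e x) = 3 -> t -- dst (s x) ->
  (t -- tail x) && (t != dst x) || (t -- dst x) && (t != tail x) -> (len x == 3) || (5 < len x).
Proof.
move=> xW l3 tr tx; have := len_gt2 xW.
have n4 : len x <> 4.
  move=> l4; have [[ab bc cd da [n_ac n_bd]] _] := quad_face xW l4.
  have [ra rb rc rd] := quad_apex xW l4 l3.
  case/orP: tx => /andP[t1 t2].
    exact: (@quad_triangle_diamond G no_C5_two_C3 _ _ _ _ _ ab bc cd da n_ac n_bd ra rb rc rd _ tr t1 t2).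
  exact: (@quad_triangle_diamond' G no_C5_two_C3 _ _ _ _ _ ab bc cd da n_ac n_bd ra rb rc rd _ tr t1 t2).
have n5 : len x <> 5.
  move=> l5; have [[ab bc cd dg ga] [n_ac n_ad n_bd n_bg n_cg]] := pent_face xW l5.
  have [ra rb n_rc] := triangle_apex xW l3.
  case/orP: tx => /andP[t1 t2]; last first.
    apply: (@no_adjacent_diamond G _ _ _ _ _ ab bc cd dg ga n_ac n_ad n_bd n_bg n_cg) ra rb t1 tr t2.
    exact: no_C5_chorded_C4.
  (* Mirror image of the previous case: the 5-face is read backwards. *)
  by apply: (@no_adjacent_diamond G (dst x) (tail x) (dst (f (f (f x)))) (dst (f (f x)))
     (dst (f x)) _ _ _ _ _ _ _ _ _ _ _ (dst (s x)) t); try adj_or_neq.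
lia.
Qed.

(** Both faces lie across an outer side of the diamond. [face_across_diamond] leaves only length 3
    below 6, and that would be a third consecutive triangle. *)
Lemma diamond_neighbors y : y \in W ->
    len (s y) = 3 -> len (s (s y)) = 3 ->
  5 < len y /\ 5 < len (s (s (s y))).
Proof.
move=> yW l1 l2; have syW : s y \in W by rewrite s_in.
have t1 : dst y -- dst (s y) by apply: triangle_corner.
have t2 : dst (s y) -- dst (s (s y)) by apply: triangle_corner.
split.
  have /orP[/eqP l0|//] : (len y == 3) || (5 < len y).
    apply: (@face_across_diamond y (dst (s (s y)))) => //.
    - by rewrite -len_s.
    - by rewrite sedge_sym.
    - by rewrite sedge_sym -(tail_s yW) -(tail_s syW) edge_dart eq_sym spoke_neq2.
  by case: (no_three_triangles yW).
have ssyW : s (s y) \in W by rewrite !s_in.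
rewrite len_s; have /orP[/eqP l3|//] : (len (e (s (s y))) == 3) || (5 < len (e (s (s y)))).
  apply: (@face_across_diamond _ (dst y)); rewrite ?e_in ?eK ?tail_e ?dst_e //.
    rewrite -fE -[dst (f _)]tail_f ?f_in // (_ : f _ = e (s y)) ?tail_e //.
    exact: (@last_side _ 2).
  rewrite tail_s // tail_s // spoke_neq2 // andbT.
  by rewrite [dst y -- tail y]sedge_sym edge_dart orbT.
by case: (no_three_triangles syW) => //; rewrite len_s.
Qed.

(** * Big and bad corners in a minimal uncolorable set *)

Variables (C : finType) (L : G -> {set C}).
Hypothesis cardL : forall v, #|L v| = 4.
Hypothesis uncolorable : ~ list_colorable L A.
Hypothesis critical : forall B : {set G}, B \proper A -> list_colorable L B.

Lemma porbit4 x d : len x = 4 -> d \in porbit f x ->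
  [\/ d = x, d = f x, d = f (f x) | d = f (f (f x))].
Proof.
move=> l; rewrite porbit_traject -/(face_size e s x) l /= !inE.
by case/or4P=> /eqP->; [constructor 1|constructor 2|constructor 3|constructor 4].
Qed.

(** The chord lemmas expect the triangle on the first side; rotating the face at most exchanges its
    two diagonals. *)
Lemma quad_no_chord x : x \in W -> len x = 4 -> triangle_side x ->
  ~~ tail x -- dst (f x) /\ ~~ dst x -- dst (f (f x)).
Proof.
move=> xW l4 /exists_inP[d dx /eqP l3].
have chord z : z \in W -> len z = 4 -> len (e z) = 3 ->
    ~~ tail z -- dst (f z) /\ ~~ dst z -- dst (f (f z)).
  move=> zW z4 z3; have [[ab bc cd da [n_ac n_bd]] _] := quad_face zW z4.
  have [ra rb rc rd] := quad_apex zW z4 z3; split.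
    exact: (@quad_triangle_chord1 G no_C5_two_C3 _ _ _ _ _ ab bc cd da n_ac n_bd ra rb rc rd).
  exact: (@quad_triangle_chord2 G no_C5_two_C3 _ _ _ _ _ ab bc cd da n_ac n_bd ra rb rc rd).
have [_ dE] := quad_face xW l4; have xE : f (f (f (f x))) = x by have := len_iter x; rewrite l4.
have := chord d; case: (porbit4 l4 dx) l3 => -> l3; rewrite ?f_in ?len_f //.
- exact.
- by rewrite tail_f // dE => /(_ xW l4 l3)[? ?]; split; adj.
- by rewrite tail_f ?f_in // dE xE => /(_ xW l4 l3)[? ?]; split; adj.
- by rewrite tail_f ?f_in // dE xE => /(_ xW l4 l3)[? ?]; split; adj.
Qed.

Lemma quad_big_corner x : x \in W -> len x = 4 -> triangle_side x ->
  exists2 d, d \in porbit f x & 4 < deg d.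
Proof.
move=> xW l4 tx; have [N_ac N_bd] := quad_no_chord xW l4 tx.
have [[ab bc cd da [n_ac n_bd]] dE] := quad_face xW l4.
have [|v] := critical_quad cardL uncolorable critical ab bc cd da N_ac N_bd n_ac n_bd.
  by move=> w; rewrite !inE => /or4P[]/eqP->; rewrite ?tail_in ?dst_in ?f_in.
have fx i : iter i f x \in porbit f x by rewrite -permX mem_porbit.
rewrite !inE => /or4P[]/eqP-> big.
- by exists x; rewrite ?degE //; apply: (fx 0).
- by exists (f x); rewrite ?degE ?tail_f ?f_in //; apply: (fx 1).
- by exists (f (f x)); rewrite ?degE ?tail_f ?f_in //; apply: (fx 2).
- by exists (f (f (f x))); rewrite ?degE ?tail_f ?f_in //; apply: (fx 3).
Qed.

(* Q = v p y q is the quadrilateral at the corner s y between the spokes y and s y. *)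
Lemma bad_corner y (x := s y) (v := tail y) (p := dst y) (w := dst (f x)) (q := dst x) :
    y \in W -> bad x ->
  [/\ [/\ v -- p, p -- w, w -- q & q -- v],
      [/\ v != w, p != q, ~~ v -- w & ~~ p -- q],
      [/\ deg_in A v = 5, deg_in A p <= 4, deg_in A w <= 4 & deg_in A q <= 4],
      [/\ v \in A, p \in A, w \in A & q \in A]
    & [\/ len (s x) = 3 /\ has_apex v q, exists2 r, r = dst (s (f x)) & r -- q /\ r -- w,
          has_apex w p
        | exists2 r, r = dst ((s^-1)%g y) & r -- v /\ r -- p]].
Proof.
move=> yW /and5P[/eqP l4 tx /eqP d5 d1 /andP[d2 d3]].
have xW : x \in W by rewrite s_in.
have [[ab bc cd da [n_ac n_bd]] dE] := quad_face xW l4.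
have [N_ac N_bd] := quad_no_chord xW l4 tx.
have tx' : tail x = v by rewrite tail_s.
have fE' : f (f (f x)) = e y by apply: (@last_side _ 3).
have pE : dst (f (f x)) = p by rewrite -[dst (f (f _))]tail_f ?f_in // fE' tail_e.
rewrite tx' pE in ab bc cd da n_ac n_bd N_ac N_bd.
move: d5 d1 d2 d3; rewrite !degE ?f_in // fE' !tail_f ?f_in // tail_e // tx' => d5 d1 d2 d3.
have fx : dst (f x) = w by [].
split; [by split; adj|by split; adj_or_neq|by []| |].
  by split; rewrite ?tail_in ?dst_in ?f_in.
(* The cases say which of the sides [v q], [q w], [w p], [p v] of Q carries the triangle; some also
   name its apex by a dart, so that it can later be distinguished from other spoke ends. *)
have [d dx /eqP l3] := exists_inP tx; case: (porbit4 l4 dx) l3 => -> l3.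
- constructor 1; split; first by rewrite len_s.
  by have [] := triangle_apex xW l3; rewrite tx' => r1 r2 _; exists (dst (s x)).
- constructor 2; have [] := triangle_apex (_ : f x \in W) l3; rewrite ?f_in ?tail_f //.
  by move=> r1 r2 _; eexists.
- constructor 3; have [] := triangle_apex (_ : f (f x) \in W) l3; rewrite ?tail_f ?f_in //.
  by rewrite pE => r1 r2 _; exists (dst (s (f (f x)))); split.
constructor 4; exists (dst ((s^-1)%g y)) => //.
pose z := (s^-1)%g y; have zW : z \in W by rewrite -s_in permKV.
have szy : s z = y by rewrite permKV.
move: l3; rewrite fE' eK => l3.
have := triangle_corner zW; rewrite szy => /(_ l3) zp; split=> //.
by have := edge_dart z; rewrite -(tail_s zW) szy sedge_sym.
Qed.

(** The two quadrilaterals share the spoke to [q]. The triangle side of the first is not that spoke,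
    across which the second lies. In each other position it excludes the edges [p q'] and [w w'],
    and [critical_shared_spoke] applies. *)
Lemma bad_corners_not_adjacent y : y \in W -> bad (s y) -> bad (s (s y)) -> False.
Proof.
move=> yW bx bx'; have xW : s y \in W by rewrite s_in.
have [[vp pw wq qv] [n_vw n_pq N_vw N_pq] [dv dp dw dq] [vA pA wA qA] T] := bad_corner yW bx.
have := bad_corner xW bx'; rewrite (tail_s yW).
move=> [[vq qw' w'q' q'v] [n_vw' n_qq' N_vw' N_qq'] [_ _ dw' dq'] [_ _ w'A q'A] T'].
set v := tail y in vp qv n_vw N_vw dv vA vq q'v n_vw' N_vw' T T' *.
set p := dst y in vp pw n_pq N_pq dp pA T.
set w := dst (f (s y)) in pw wq n_vw N_vw dw wA T.
set q := dst (s y) in wq qv n_pq N_pq dq qA T vq qw' n_qq' N_qq' T'.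
set w' := dst (f (s (s y))) in qw' w'q' n_vw' N_vw' dw' w'A T'.
set q' := dst (s (s y)) in w'q' q'v n_qq' N_qq' dq' q'A T'.
have n_pq' : p != q' by apply: spoke_neq2.
have /and5P[/eqP l4' _ _ _ _] := bx'.
have z_neq : dst ((s^-1)%g y) != q'.
  have zW : (s^-1)%g y \in W by rewrite -s_in permKV.
  by have := spoke_neq3 zW; rewrite permKV.
have N_pq' : ~~ p -- q'.
  apply: (@no_cross_edge G no_C5_two_C3 v p w q q' w' q); try adj_or_neq.
  case: T => [[l3 _]|[r _ [? ?]]|?|[r rE [? ?]]].
  - by rewrite l3 in l4'.
  - by constructor 2; exists r.
  - by constructor 3.
  - by constructor 4; exists r; split=> //; rewrite rE.
have N_ww' : ~~ w -- w'.
  apply: (@no_tip_edge_shared G no_C5_two_C3 v p w q w' q'); try adj_or_neq.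
  case: T => [[l3 _]|[r rE [? ?]]|[r [? ?]]|[r rE [? ?]]].
  - by rewrite l3 in l4'.
  - constructor 3; exists r; split=> //; rewrite rE.
    (* Around [q], the spokes to [w'], [v], [w] and the apex [r] are consecutive, starting from [h];
       hence [r != w']. *)
    pose h := e (f (f (s (s y)))).
    have hW : h \in W by rewrite e_in !f_in !s_in.
    have sh : s h = e (s y) by rewrite -fE; apply: (@last_side _ 3).
    have := spoke_neq3 hW; rewrite sh -fE dst_e ?f_in ?s_in // tail_f ?f_in ?s_in //.
    by rewrite eq_sym.
  - by constructor 2; exists r.
  - by constructor 1; exists r.
apply: (@critical_shared_spoke _ _ _ _ cardL uncolorable critical v p w q w' q') => //.
- by move=> u; rewrite !inE; do 5?[case/orP]; move=> /eqP->.
- by rewrite /allrel /= !sedge_irrefl !(nonadjF N_vw) !(nonadjF N_vw') !(nonadjF N_ww').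
- by rewrite /allrel /= !sedge_irrefl !(nonadjF N_pq) !(nonadjF N_qq') !(nonadjF N_pq').
- by rewrite /= !inE negb_or n_pq n_pq' n_qq'.
- by rewrite dv.
- by move=> u; rewrite !inE; do 4?[case/orP]; move=> /eqP->.
Qed.

(** If the corner between is not a triangle, the first quadrilateral has its triangle on a side
    other than [v q]. This excludes all edges between spoke ends of different quadrilaterals.
    Together with the triangle of the second it excludes [w w'], and [critical_two_quads]
    applies. *)
Lemma bad_corners_two_apart y : y \in W -> bad (s y) -> bad (s (s (s y))) ->
  len (s (s y)) = 3.
Proof.
move=> yW bx bx'; apply/eqP/negPn/negP=> /eqP l3.
have y'W : s (s y) \in W by rewrite !s_in.
have [[vp pw wq qv] [n_vw n_pq N_vw N_pq] [dv dp dw dq] [vA pA wA qA] T] := bad_corner yW bx.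
have := bad_corner y'W bx'; rewrite !tail_s ?s_in //.
move=> [[vp' p'w' w'q' q'v] [n_vw' n_p'q' N_vw' N_p'q'] [_ dp' dw' dq'] [_ p'A w'A q'A] T'].
set v := tail y in vp qv n_vw N_vw dv vA vp' q'v n_vw' N_vw' T T' *.
set p := dst y in vp pw n_pq N_pq dp pA T.
set w := dst (f (s y)) in pw wq n_vw N_vw dw wA T.
set q := dst (s y) in wq qv n_pq N_pq dq qA T.
set p' := dst (s (s y)) in vp' p'w' n_p'q' N_p'q' dp' p'A T'.
set w' := dst (f (s (s (s y)))) in p'w' w'q' n_vw' N_vw' dw' w'A T'.
set q' := dst (s (s (s y))) in w'q' q'v n_p'q' N_p'q' dq' q'A T'.
have n_pp' : p != p' by apply: spoke_neq2.
have n_pq' : p != q' by apply: spoke_neq3.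
have n_qp' : q != p' by rewrite spoke_neq1 ?s_in.
have n_qq' : q != q' by rewrite spoke_neq2 ?s_in.
(* As [v] has degree 5, [z] is its fifth spoke, so a possible apex [dst z] differs from the other
   four ends. *)
pose z := (s^-1)%g y; have szy : s z = y by rewrite permKV.
have zW : z \in W by rewrite -s_in szy.
have n_zp' : dst z != p' by have := spoke_neq3 zW; rewrite szy.
have n_zq' : dst z != q'.
  have := @spoke_neq 0 4 z zW; rewrite /= szy; apply.
  by rewrite degE // -(tail_s zW) szy dv.
have TP : [\/ has_apex v q, has_apex q w, has_apex w p
    | exists r, [/\ r -- v, r -- p & r = dst z]].
  case: T => [[l3' _]|[r _ [? ?]]|?|[r rE [? ?]]].
  - by case: l3; rewrite l3'.
  - by constructor 2; exists r.
  - by constructor 3.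
  - by constructor 4; exists r; split.
have cross_p b b' : v -- b -> b -- w' -> w' -- b' -> b' -- v -> b != b' ->
    p != b' -> b != q -> dst z != b -> ~~ p -- b.
  move=> vb bw' w'b' b'v n_bb' n_pb' n_bq n_zb.
  apply: (@no_cross_edge G no_C5_two_C3 v p w q b w' b'); try adj_or_neq.
  case: TP => [?|?|?|[r [? ? rE]]]; [constructor 1|constructor 2|constructor 3|constructor 4] => //.
  by exists r; split=> //; rewrite rE.
have cross_q b b' : v -- b -> b -- w' -> w' -- b' -> b' -- v -> b != b' ->
    q != b' -> b != p -> ~~ q -- b.
  move=> vb bw' w'b' b'v n_bb' n_qb' n_bp.
  apply: (@no_cross_edge G no_C5_two_C3 v q w p b w' b'); try adj_or_neq.
  case: T => [[l3' _]|[r _ [? ?]]|[r [? ?]]|[r _ [? ?]]].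
  - by case: l3; rewrite l3'.
  - by constructor 3; exists r.
  - by constructor 2; exists r.
  - by constructor 1; exists r.
have N_pp' : ~~ p -- p' by apply: (cross_p p' q'); adj_or_neq.
have N_pq' : ~~ p -- q' by apply: (cross_p q' p'); adj_or_neq.
have N_qp' : ~~ q -- p' by apply: (cross_q p' q'); adj_or_neq.
have N_qq' : ~~ q -- q' by apply: (cross_q q' p'); adj_or_neq.
have N_ww' : ~~ w -- w'.
  (* [b] is the one of [p'] and [q'] for which the triangle of the second quadrilateral lies on
     [v b] or [b w']. *)
  have [b [vb bw' [n_pb n_qb n_zb] T2]] : exists b, [/\ v -- b, b -- w',
      [/\ p != b, q != b & dst z != b] & has_apex b w' \/ has_apex v b].
    case: T' => [[_ ?]|[r _ [? ?]]|[r [? ?]]|[r _ [? ?]]].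
    - by exists q'; split; [adj|adj|by split; adj_or_neq|right].
    - by exists q'; split; [adj|adj|by split; adj_or_neq|left; exists r].
    - by exists p'; split; [adj|adj|by split; adj_or_neq|left; exists r].
    - by exists p'; split; [adj|adj|by split; adj_or_neq|right; exists r].
  case: T => [[l3' _]|[r _ [? ?]]|[r [? ?]]|[r rE [? ?]]].
  - by case: l3; rewrite l3'.
  - apply: (@no_tip_edge G no_C5_two_C3 v q w b w'); try adj_or_neq.
    by left; exists r.
  - apply: (@no_tip_edge G no_C5_two_C3 v p w b w'); try adj_or_neq.
    by left; exists r.
  - apply: (@no_tip_edge G no_C5_two_C3 v p w b w'); try adj_or_neq.
    by right; exists r; split=> //; rewrite rE.
apply: (@critical_two_quads _ _ _ _ cardL uncolorable critical v p w q p' w' q') => //.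
- by move=> u; rewrite !inE; do 6?[case/orP]; move=> /eqP->.
- by rewrite /allrel /= !sedge_irrefl !(nonadjF N_vw) !(nonadjF N_vw') !(nonadjF N_ww').
- by rewrite /allrel /= !sedge_irrefl !(nonadjF N_pq) !(nonadjF N_p'q') !(nonadjF N_pp')
    !(nonadjF N_pq') !(nonadjF N_qp') !(nonadjF N_qq').
- by rewrite /= !inE !negb_or n_pq n_pp' n_pq' n_qp' n_qq' n_p'q'.
- by rewrite dv.
- by move=> u; rewrite !inE; do 5?[case/orP]; move=> /eqP->.
Qed.

End LocalStructure.

(** * Minimal uncolorable sets and the conclusion *)

Definition list_colorableb (G : sgraph) (C : finType) (L : G -> {set C})
    (A : {set G}) : bool :=
  [exists c : {ffun G -> C}, [forall v in A, c v \in L v] &&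
    [forall u in A, forall v in A, (u -- v) ==> (c u != c v)]].

(** The boolean form allows taking a minimal uncolorable set with [ex_minset]. *)
Lemma list_colorableP (G : sgraph) (C : finType) (L : G -> {set C}) (A : {set G}) :
  reflect (list_colorable L A) (list_colorableb L A).
Proof.
apply: (iffP existsP) => [[c /andP[/forall_inP cL /forall_inP cP]]|[c cL cP]].
  by exists c => // u v uA vA; apply/implyP; move/forall_inP: (cP u uA); apply.
exists [ffun v => c v]; apply/andP; split; apply/forall_inP=> u uA; rewrite ?ffunE ?cL //.
by apply/forall_inP=> v vA; apply/implyP; rewrite !ffunE; apply: cP.
Qed.

Theorem theorem2 (G : sgraph)
  (planarG : planar G)
  (no_C5_two_C3 : ~ exists c t1 t2 : seq G,
     [/\ kcycle 5 c, kcycle 3 t1 & kcycle 3 t2] /\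
     [/\ cycle_edges t1 <> cycle_edges t2,
         adjacent_cycles c t1 & adjacent_cycles c t2])
  (no_C5_chorded_C4 : ~ exists c q : seq G,
     [/\ kcycle 5 c, kcycle 4 q, has_chord q & adjacent_cycles c q]) :
  choosable G 4.
Proof.
move=> C L cardL.
suff: list_colorable L [set: G].
  by case=> c cL cP; exists c; split=> [v|u v]; [exact: cL|apply: cP].
apply/list_colorableP; apply: contraT => uncol.
have [A /minsetP[/list_colorableP uncolA minA]] :=
  ex_minset (ex_intro (fun A => ~~ list_colorableb L A) _ uncol).
have critA (B : {set G}) : B \proper A -> list_colorable L B.
  move=> ltBA; apply/list_colorableP; apply: contraT => /minA BA.
  by have := ltBA; rewrite (BA (proper_sub ltBA)) properxx.
have mindeg : {in A, forall v, 4 <= deg_in A v} by move=> v; apply: (critical_deg cardL uncolA critA).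
have [v vA] : exists v, v \in A.
  apply/set0Pn; apply: contra_not_neq uncolA => ->.
  (* The empty set is colorable, because nonempty lists provide at least one function into [C]. *)
  have L_gt0 v : exists x, x \in L v by apply/card_gt0P; rewrite cardL.
  by exists (fun v => xchoose (L_gt0 v)) => [v|u v]; rewrite inE.
have [e [s [pl e_rev s_rot e_out s_out]]] := planar_induced A planarG.
have eKd := eK e_rev e_out.
have W0 : darts_in A != set0.
  have /card_gt0P[w] : 0 < deg_in A v by apply: ltn_trans (mindeg v vA).
  rewrite inE => /andP[wA vw]; apply/set0Pn.
  by exists (exist _ (v, w) vw); rewrite inE vA.
exfalso; apply: (discharging e_out s_out eKd) W0 pl => [d dW|d dW|x xW|y yW|x xW|x xW|y yW|y yW|d dW].
- exact: len_gt2 dW.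
- exact: deg_ge4 dW.
- exact: no_three_triangles xW.
- exact: diamond_neighbors yW.
- exact: one_triangle_side xW.
- exact: quad_big_corner xW.
- exact: bad_corners_not_adjacent yW.
- exact: bad_corners_two_apart yW.
rewrite e_rev //; apply: contraTneq (edge_dart d) => de.
by rewrite -[dst d]/(tail (rev_dart d)) de sedge_irrefl.
Qed.
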